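(* Let $\sigma>d/2$, $0\le m\le\sigma$, $0\le\tau\le m$, $0<\rho_0<1$, and set $s=\tau+\sigma$. Suppose the scaled zonal kernels $\varphi_\rho$ satisfy the following, with constants $c_1,c_2>0$ and $0<c_3\le c_4<\infty$ independent of $\ell$ and $\rho$, for all $0<\rho<\rho_0$: (i) $|1-\widehat{\varphi_\rho}(\ell)|\le c_1\ell^m\rho^m$ for $0\le\ell\le\ell_\rho:=\lfloor\rho^{-1}-1\rfloor$; (ii) $\widehat{\varphi_\rho}(\ell)\le c_2$ for $\ell>\ell_\rho$; (iii) $c_3(1+\rho\ell)^{-2s}\le\widehat{\varphi_\rho}(\ell)\le c_4(1+\rho\ell)^{-2s}$ for all $\ell>0$. Let $X^q=\{x_1,\dots,x_N\}\subset\mathbb S^d$ be a QMC design for $H^\sigma(\mathbb S^d)$, let $f\in H^\sigma(\mathbb S^d)$, and let $$\mathcal Q^q_{\varphi_\rho}f(x)=\frac1N\sum_{j=1}^N f(x_j)\,\varphi_\rho(x\cdot x_j),\qquad x\in\mathbb S^d.$$ Then there exists a constant $C>0$ independent of $\rho$ and $N$ such that for $0<\rho<\rho_0$ $$\|f-\mathcal Q^q_{\varphi_\rho}f\|_{H^\tau}\le C\big(\rho^{m-\tau}+\rho^{-s}N^{-\sigma/d}\big)\|f\|_{H^\sigma}.$$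
   Context: $\mathbb S^d=\{x\in\mathbb R^{d+1}:\|x\|=1\}$ and $\mu$ is the rotationally invariant measure on $\mathbb S^d$, normalized so that $\mu(\mathbb S^d)=1$. $\{\mathcal Y_{\ell,k}:k=1,\dots,Z(d,\ell),\ \ell=0,1,\dots\}$ is an orthonormal basis of $L_2(\mathbb S^d)=L_2(\mathbb S^d,\mu)$ of spherical harmonics ($\mathcal Y_{\ell,k}$ of degree $\ell$; $Z(d,\ell)$ is the dimension of the space of spherical harmonics of degree $\ell$). For $f\in L_2(\mathbb S^d)$, $\widehat f_{\ell,k}=\int_{\mathbb S^d}f\,\overline{\mathcal Y_{\ell,k}}\,d\mu$; for $\sigma\ge0$, $H^\sigma=H^\sigma(\mathbb S^d)$ is the space of $f\in L_2(\mathbb S^d)$ with $\|f\|_{H^\sigma}^2=\sum_{\ell\ge0}\sum_{k=1}^{Z(d,\ell)}(1+\ell)^{2\sigma}|\widehat f_{\ell,k}|^2<\infty$. Scaled zonal kernel: let $\phi\in C[0,\infty]$, $\Phi(x)=\phi(\|x\|)$ on $\mathbb R^{d+1}$, $\Phi_\rho(x)=\Phi(\rho^{-1}x)$ for $0<\rho<1$. Then $\varphi_\rho(x\cdot y)=\Lambda_{\phi,\rho}^{-1}\Phi_\rho(x-y)$ for $x,y\in\mathbb S^d$, where $\Lambda_{\phi,\rho}=\int_{\mathbb S^d}\Phi_\rho(x-y)\,d\mu(x)$ (independent of $y$). Its Fourier–Legendre coefficients $\widehat{\varphi_\rho}(\ell)$ are defined by $\varphi_\rho(x\cdot y)=\sum_{\ell\ge0}\widehat{\varphi_\rho}(\ell)\sum_{k=1}^{Z(d,\ell)}\mathcal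 Y_{\ell,k}(x)\mathcal Y_{\ell,k}(y)$ (equivalently, $\int_{\mathbb S^d}\varphi_\rho(x\cdot y)\mathcal Y_{\ell,k}(y)\,d\mu(y)=\widehat{\varphi_\rho}(\ell)\mathcal Y_{\ell,k}(x)$). QMC designs: for $\sigma>d/2$, a sequence of $N$-point sets $\{x_1,\dots,x_N\}\subset\mathbb S^d$ is a (sequence of) QMC design(s) for $H^\sigma(\mathbb S^d)$ if there is $C(\sigma,d)>0$ independent of $N$ such that $\big|\frac1N\sum_{j=1}^N g(x_j)-\int_{\mathbb S^d}g\,d\mu\big|\le C(\sigma,d)N^{-\sigma/d}\|g\|_{H^\sigma}$ for all $g\in H^\sigma(\mathbb S^d)$. *)

(* Defs.v *)
From HB Require Import structures.
From mathcomp.multinomials Require Import -(notations) mpoly.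
From mathcomp Require Import all_boot all_order all_algebra.
From mathcomp Require Import all_classical all_reals all_analysis.
From mathcomp Require Import complex.

Set Implicit Arguments.
Unset Strict Implicit.
Unset Printing Implicit Defensive.

Import Order.TTheory GRing.Theory Num.Theory.
Import numFieldNormedType.Exports.

Local Open Scope classical_set_scope.
Local Open Scope complex_scope.
Local Open Scope ring_scope.

Section Sphere.
Context {R : realType} {d : nat}.

(* Functions on the sphere are represented by functions on the ambient space
   R^(d+1); every notion below only depends on their values on the sphere. *)
(* R^(d+1) with its Borel sigma-algebra *)
Definition borel_space := g_sigma_algebraType (@open 'rV[R]_d.+1).

(* The Euclidean norm; the library norm on 'rV[R]_n is the sup norm. *)
Definition enorm (x : 'rV[R]_d.+1) : R := Num.sqrt (\sum_i x 0 i ^+ 2).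

Definition sphere : set 'rV[R]_d.+1 := [set x | enorm x = 1].

Definition is_rotation (U : 'M[R]_d.+1) : Prop :=
  U *m U^T = 1%:M /\ \det U = 1.

(* mu is a Borel probability measure on R^(d+1) carried by the sphere and
   invariant under rotations; such a measure is unique for d >= 1. *)
Definition rotation_invariant (mu : probability borel_space R) : Prop :=
  mu (sphere : set borel_space) = 1%E /\
  forall U : 'M[R]_d.+1, is_rotation U ->
  forall A : set borel_space, measurable A ->
    mu ((fun x : 'rV[R]_d.+1 => x *m U) @^-1` A) = mu A.

(* restrictions to the sphere of homogeneous harmonic polynomials of degree l *)
Definition spherical_harmonic (l : nat) (H : 'rV[R]_d.+1 -> R) : Prop :=
  exists p : mpoly d.+1 R,
    [/\ p \is ishomog1 l mdeg,
        \sum_i mderiv i (mderiv i p) = 0 &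
        forall x, sphere x -> H x = meval (fun i => x 0 i) p].

Section Measure.
Variable mu : probability borel_space R.

Definition sint (f : 'rV[R]_d.+1 -> R) : R :=
  Rintegral mu sphere (f : borel_space -> R).

Definition csint (f : 'rV[R]_d.+1 -> R[i]) : R[i] :=
  sint (fun x => complex.Re (f x)) +i* sint (fun x => complex.Im (f x)).

Definition L2sq (f : 'rV[R]_d.+1 -> R[i]) : \bar R :=
  (\int[mu]_(x in (sphere : set borel_space))
     ((Normc.normc (f x) ^+ 2)%:E))%E.

Definition in_L2 (f : 'rV[R]_d.+1 -> R[i]) : Prop :=
  [/\ measurable_fun (sphere : set borel_space) (fun x => complex.Re (f x)),
      measurable_fun (sphere : set borel_space) (fun x => complex.Im (f x)) &
      (L2sq f < +oo)%E].

Definition scontinuous (f : 'rV[R]_d.+1 -> R[i]) : Prop :=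
  {within sphere, continuous (fun x => complex.Re (f x))} /\
  {within sphere, continuous (fun x => complex.Im (f x))}.

(* The continuous representative of the mu-a.e. class of f, which exists by
   Sobolev embedding when f is in H^sigma with sigma > d/2; point values of
   elements of H^sigma are those of this representative.  It is unique on the
   sphere for a rotation invariant mu.  Without one, the value is f itself. *)
Definition crep (f : 'rV[R]_d.+1 -> R[i]) : 'rV[R]_d.+1 -> R[i] :=
  xget f [set g | scontinuous g /\
                  {ae mu, forall x : borel_space, g x = f x}].

Section Basis.
Variables (Z : nat -> nat) (Y : nat -> nat -> 'rV[R]_d.+1 -> R).

(* The Y l k are real-valued, so no conjugate is needed here. *)
Definition fcoef (f : 'rV[R]_d.+1 -> R[i]) (l k : nat) : R[i] :=
  csint (fun x => f x * (Y l k x)%:C).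

(* The Y l k, k < Z l, are spherical harmonics of degree l spanning all of
   them (so that Z l is the dimension of that space), they are orthonormal,
   and every function in L_2 is the L_2-limit of its Fourier series. *)
Definition harmonic_basis : Prop :=
  [/\ forall l k, (k < Z l)%N -> spherical_harmonic l (Y l k),
      forall l H, spherical_harmonic l H ->
        exists c : nat -> R, forall x, sphere x ->
          H x = \sum_(k < Z l) c k * Y l k x,
      forall l k l' k', (k < Z l)%N -> (k' < Z l')%N ->
        sint (fun x => Y l k x * Y l' k' x) = ((l == l') && (k == k'))%:R &
      forall f, in_L2 f ->
        L2sq (fun x => f x - \sum_(l < n) \sum_(k < Z l)
                               fcoef f l k * (Y l k x)%:C)
          @[n --> \oo] --> 0%E].

(* takes the value +oo outside H^sigma *)
Definition sobolev_norm (sigma : R) (f : 'rV[R]_d.+1 -> R[i]) : \bar R :=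
  sqrte (\sum_(0 <= l <oo) \sum_(k < Z l)
    ((1 + l%:R) `^ (2 * sigma) * Normc.normc (fcoef f l k) ^+ 2)%:E)%E.

Definition in_sobolev (sigma : R) (f : 'rV[R]_d.+1 -> R[i]) : Prop :=
  in_L2 f /\ (sobolev_norm sigma f < +oo)%E.

(* X i is the i-th point set of the sequence and N i its cardinality. *)
Definition qmc_design (sigma : R) (N : nat -> nat)
    (X : forall i, 'I_(N i) -> 'rV[R]_d.+1) : Prop :=
  (forall i, [/\ (0 < N i)%N, injective (X i) & forall j, sphere (X i j)]) /\
  exists C : R, 0 < C /\
    forall i g, in_sobolev sigma g ->
      ((Normc.normc ((N i)%:R^-1 * (\sum_j crep g (X i j)) - csint g))%:E
        <= (C * (N i)%:R `^ (- (sigma / d%:R)))%:E * sobolev_norm sigma g)%E.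

Section Kernel.
Variable phi : R -> R.

Definition Phi (rho : R) (x : 'rV[R]_d.+1) : R := phi (enorm (rho^-1 *: x)).

Definition Lambda (rho : R) (y : 'rV[R]_d.+1) : R :=
  sint (fun x => Phi rho (x - y)).

(* varphi_rho (x . y), as a function of the points x and y of the sphere;
   Lambda rho y does not depend on y in the sphere. *)
Definition zonal (rho : R) (x y : 'rV[R]_d.+1) : R :=
  (Lambda rho y)^-1 * Phi rho (x - y).

Definition fourier_legendre (rho : R) (a : nat -> R) : Prop :=
  forall l k x, (k < Z l)%N -> sphere x ->
    sint (fun y => zonal rho x y * Y l k y) = a l * Y l k x.

Definition quasi_interp (rho : R) (N : nat) (X : 'I_N -> 'rV[R]_d.+1)
    (f : 'rV[R]_d.+1 -> R[i]) (x : 'rV[R]_d.+1) : R[i] :=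
  N%:R^-1 * \sum_j crep f (X j) * (zonal rho x (X j))%:C.

End Kernel.
End Basis.
End Measure.
End Sphere.

Arguments borel_space : clear implicits.

(* C[0, oo]: continuous on [0, oo) with a finite limit at infinity *)
Definition continuous_0oo (R : realType) (phi : R -> R) : Prop :=
  {within `[0, +oo[, continuous phi} /\
  exists L : R, phi x @[x --> +oo] --> L.

(* Main.v *)
Require Import Defs.
From HB Require Import structures.
From mathcomp.multinomials Require Import -(notations) mpoly.
From mathcomp Require Import all_boot all_order all_algebra.
From mathcomp Require Import all_classical all_reals all_analysis.
From mathcomp Require Import measurable_realfun complex ring lra zify.

(** The error [f - Q f] splits into the error [f - phi * f] of the convolution
    with the kernel and the quadrature error [phi * f - Q f].  By the symmetry
    of the kernel, its Fourier coefficients are those of [f] multiplied by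
    [1 - phihat l], plus [phihat l] times the error of the design on the
    integrand [f * Y l k].

    The convolution error is estimated degree by degree
    ([convolution_multiplier]): below the cut-off the approximation order of
    the kernel gains [rho ^ (m - tau)], and above it the weights of the two
    Sobolev norms differ by that factor already.

    For the quadrature error, the weighted sum [G] of the squared errors on all
    the products [f * Y l k] with [l < L] is itself the error of the design on
    a single integrand [f * h], where [h] is the polynomial whose coefficients
    are the weighted errors ([quad_error_bound]).  The design bounds it by the
    Sobolev norm of [f * h].  Since [H^sigma] is an algebra for
    [sigma > d / 2], this is at most a constant times the norms of [f] and of
    [h], and the decay of [phihat] bounds the norm of [h] by
    [rho ^ (- s) * sqrt G].  Dividing by [sqrt G] gives a bound which does not
    depend on [L].

    The algebra property ([sobolev_algebra]) comes from best approximation.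
    With [S_n] the Fourier sum of degree less than [n], the product
    [S_n f * S_n h] is a polynomial of degree less than [2 n], so that the part
    of [f * h] of degree at least [2 n] has norm at most
    [|| (f - S_n f) h || + || S_n f (h - S_n h) ||].  The sup norms of [h] and
    of [S_n f] are bounded by Sobolev norms, and a summation by parts over [n]
    turns the tails of [f] and [h] into their Sobolev norms.

    Three facts on spherical harmonics enter: a polynomial of degree [n] is on
    the sphere a sum of harmonics of degree at most [n]
    ([fischer_decomposition], [homog_hspan]); the sum of the squares of the
    harmonics of degree [l] is the constant [Z l], by rotation invariance
    ([addition_theorem]); and [Z l] is at most [2 (l + 1) ^ (d - 1)]
    ([harmonic_dimension]).  The last two and [sigma > d / 2] give the sup norm
    bound ([comb_sup_bound]), which also provides the continuous representative
    of [f] ([sobolev_embedding]).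

    The basis being real, real and imaginary parts are treated separately. *)

Set Implicit Arguments.
Unset Strict Implicit.
Unset Printing Implicit Defensive.

Import Order.TTheory GRing.Theory Num.Theory.
Import numFieldNormedType.Exports.

Local Open Scope ring_scope.

(** * Harmonic polynomials *)

Section Fischer.
Context {R : realType} {n : nat}.
Implicit Types (p q h : mpoly n R) (k : nat).

Local Notation homog k p := (p \is ishomog1 k mdeg).
Local Notation Xv i := (mpolyX R (mnm1 i)).

Definition laplacian p : mpoly n R := \sum_i mderiv i (mderiv i p).
Definition radius2 : mpoly n R := \sum_i Xv i ^+ 2.

Fact laplacian_is_linear : linear laplacian.
Proof.
move=> c p q; rewrite /laplacian scaler_sumr -big_split /=.
by apply: eq_bigr => i _; rewrite !linearP.
Qed.
HB.instance Definition _ :=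
  GRing.isLinear.Build R (mpoly n R) (mpoly n R) _ laplacian
    laplacian_is_linear.

Lemma homog_coeff k p : homog k p <-> forall m, mdeg m != k -> mcoeff m p = 0.
Proof.
split=> [hp m|hp]; first exact: dhomog_nemf_coeff.
apply/dhomogP => m mp; apply/eqP/negPn/negP => /hp /eqP.
by rewrite mcoeff_eq0 mp.
Qed.

Lemma homog_mderiv k p i : homog k.+1 p -> homog k (mderiv i p).
Proof.
move=> /homog_coeff hp; apply/homog_coeff => m mk.
by rewrite mcoeff_deriv hp ?mul0rn // mdegD mdeg1 addn1 eqSS.
Qed.

Lemma homog0_mderiv p i : homog 0%N p -> mderiv i p = 0.
Proof.
move=> /homog_coeff hp; apply/mpolyP => m.
by rewrite mcoeff_deriv mcoeff0 hp ?mul0rn // mdegD mdeg1 addn1.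
Qed.

Lemma homog_laplacian k p : homog k.+2 p -> homog k (laplacian p).
Proof. by move=> hp; apply: rpred_sum => i _; do 2 apply: homog_mderiv. Qed.

Lemma homog_radius2 : homog 2%N radius2.
Proof.
apply: rpred_sum => i _; rewrite -[2%N]mul1n; apply: dhomogMn.
by rewrite dhomogX; apply/eqP; exact: mdeg1.
Qed.

Lemma laplacian_small k p : (k < 2)%N -> homog k p -> laplacian p = 0.
Proof.
move=> k2 hp; rewrite /laplacian big1 // => i _.
case: k k2 hp => [_ hp|[_ hp|//]]; first by rewrite (homog0_mderiv _ hp) mderiv0.
by rewrite homog0_mderiv //; apply: homog_mderiv.
Qed.

Lemma euler_identity k p : homog k p ->
  \sum_i Xv i * mderiv i p = k%:R *: p.
Proof.
move=> /dhomogP hp; rewrite {2}[p]mpolyE scaler_sumr.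
under eq_bigr do rewrite {1}[p]mpolyE raddf_sum mulr_sumr.
rewrite exchange_big /= !big_seq; apply: eq_bigr => m mp.
under eq_bigr => i _.
  rewrite linearZ /= mderivX -!scalerAr.
  have -> : (m i)%:R *: (Xv i * mpolyX R (mnm_sub m (mnm1 i)))
     = (m i)%:R *: mpolyX R m.
    have [->|mi0] := eqVneq (m i) 0%N; first by rewrite !scale0r.
    rewrite -mpolyXD addmC submK //; apply/mnm_lepP => j; rewrite mnm1E.
    by have [<-|] := eqVneq i j; rewrite ?lt0n.
  over.
rewrite -scaler_sumr -scaler_suml -natr_sum -mdegE (hp _ mp).
by rewrite !scalerA mulrC.
Qed.

Lemma mderiv_radius2 i : mderiv i radius2 = 2 *: Xv i.
Proof.
rewrite /radius2 raddf_sum /= (bigD1 i) //= big1 => [|j ji].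
  rewrite addr0 expr2 mderivM mderivX mnm1E eqxx.
  rewrite (_ : mnm_sub _ _ = mnm0); last first.
    by apply/mnmP => l; rewrite mnmBE subnn mnm0E.
  by rewrite mpolyX0 scale1r mul1r mulr1 -mulr2n scaler_nat.
rewrite expr2 mderivM mderivX mnm1E (negbTE ji) scale0r mul0r mulr0 addr0.
by [].
Qed.

Lemma laplacian_radius2M k q : homog k q ->
  laplacian (radius2 * q) =
  (2 * n%:R + 4 * k%:R) *: q + radius2 * laplacian q.
Proof.
move=> hq; rewrite /laplacian mulr_sumr.
have dX i : mderiv i (Xv i) = 1.
  rewrite mderivX mnm1E eqxx scale1r -mpolyX0; congr mpolyX.
  by apply/mnmP => l; rewrite mnmBE subnn mnm0E.
transitivity (\sum_i (2 *: q + 4 *: (Xv i * mderiv i q)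
                     + radius2 * mderiv i (mderiv i q))).
  apply: eq_bigr => i _.
  rewrite mderivM mderiv_radius2 mderivD !mderivM mderivZ mderiv_radius2 dX.
  rewrite -!scalerAl mul1r !addrA; congr (_ + _); rewrite -addrA; congr (_ + _).
  by rewrite -scalerDl; congr (_ *: _); ring.
rewrite !big_split /= -!scaler_sumr (euler_identity hq) scalerA.
by rewrite sumr_const card_ord -scalerMnr scalerMnl -scalerDl (mulr_natr 2).
Qed.

Lemma homog_radius2Xn k h j : homog k h -> homog (2 * j + k)%N (radius2 ^+ j * h).
Proof. by move=> hh; apply: dhomogM => //; apply: dhomogMn; exact: homog_radius2. Qed.

(** Each summand [|x|^(2 j) * h] of the Fischer decomposition is an eigenvector
    of [q |-> laplacian (|x|^2 * q)], and the eigenvalue is positive: this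
    operator can therefore be inverted on a decomposed polynomial. *)
Lemma laplacian_radius2XSn k h j : (0 < n)%N ->
  homog k h -> laplacian h = 0 ->
  exists2 c : R, 0 < c & laplacian (radius2 ^+ j.+1 * h) = c *: (radius2 ^+ j * h).
Proof.
move=> n0 hh h0; elim: j => [|j [c c0 IH]].
  exists (2 * n%:R + 4 * k%:R); last first.
    by rewrite expr1 expr0 mul1r (laplacian_radius2M hh) h0 mulr0 addr0.
  by apply: ltr_wpDr; [rewrite mulr_ge0|rewrite mulr_gt0 // ltr0n].
have hj := homog_radius2Xn j.+1 hh.
exists (2 * n%:R + 4 * (2 * j.+1 + k)%:R + c).
  by rewrite ltr_wpDl // addr_ge0 // mulr_ge0.
rewrite exprS -mulrA (laplacian_radius2M hj) IH -scalerAr mulrA -exprS.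
by rewrite -scalerDl.
Qed.

(** By induction on the degree: decompose [laplacian p], and use the previous
    lemma to solve [laplacian (|x|^2 * q) = laplacian p] summand by summand.
    Then [p - |x|^2 * q] is harmonic. *)
Lemma fischer_decomposition k p : (0 < n)%N -> homog k p ->
  exists h : nat -> mpoly n R,
    p = \sum_(j < (k./2).+1) radius2 ^+ j * h j /\
    forall j, (j <= k./2)%N -> homog (k - 2 * j)%N (h j) /\ laplacian (h j) = 0.
Proof.
move=> n0; elim/ltn_ind: k p => k IH p hp.
have [k2|k2] := ltnP k 2.
  have k20 : k./2 = 0%N by case: k k2 {IH hp} => [|[|]].
  exists (fun=> p); split; first by rewrite k20 big_ord1 expr0 mul1r.
  move=> j; rewrite k20 leqn0 => /eqP ->; rewrite muln0 subn0; split=> //.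
  exact: (laplacian_small k2).
case: k k2 IH hp => [//|[//|k]] _ IH hp.
have [h [lapE hh]] := IH k (leqnSn _) _ (homog_laplacian hp).
have /choice[c cP] : forall j : nat, exists c : R, (j <= k./2)%N ->
    0 < c /\ laplacian (radius2 ^+ j.+1 * h j) = c *: (radius2 ^+ j * h j).
  move=> j; have [jk|jk] := leqP j k./2; last by exists 0.
  have [hj hj0] := hh j jk.
  by have [c c0 cE] := laplacian_radius2XSn j n0 hj hj0; exists c.
pose q : mpoly n R := \sum_(j < (k./2).+1) (c j)^-1 *: (radius2 ^+ j.+1 * h j).
have qE : laplacian q = laplacian p.
  rewrite lapE /q raddf_sum; apply: eq_bigr => j _ /=.
  have [cj0 cjE] := cP j (ltn_ord j).
  by rewrite linearZ /= cjE scalerA mulVf ?scale1r // gt_eqF.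
exists (fun j => if j is j'.+1 then (c j')^-1 *: h j' else p - q); split.
  rewrite /= big_ord_recl expr0 mul1r /=.
  have -> : \sum_(i < (k./2).+1) radius2 ^+ bump 0 i * ((c i)^-1 *: h i) = q.
    by apply: eq_bigr => i _; rewrite -scalerAr.
  by rewrite subrK.
case=> [_|j jk].
  rewrite muln0 subn0; split; last by rewrite raddfB /= qE subrr.
  apply: rpredB => //; apply: rpred_sum => j _; apply: rpredZ.
  have jk : (j <= k./2)%N := ltn_ord j.
  have [hj _] := hh j jk; have := homog_radius2Xn j.+1 hj.
  suff -> : (2 * j.+1 + (k - 2 * j))%N = k.+2 by [].
  by have := odd_double_half k; lia.
have {}jk : (j <= k./2)%N by [].
have [hj hj0] := hh j jk; rewrite linearZ /= hj0 scaler0; split=> //.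
apply: rpredZ; suff -> : (k.+2 - 2 * j.+1 = k - 2 * j)%N by [].
by rewrite mulnS !subSS.
Qed.

End Fischer.

Section LinearSubstitution.
Context {R : realType} {n : nat}.

Local Notation homog k p := (p \is ishomog1 k mdeg).
Local Notation Xv i := (mpolyX R (mnm1 i)).

Lemma homog_prodXn (F : 'I_n -> mpoly n R) (m : 'I_n -> nat) :
  (forall i, homog 1%N (F i)) ->
  homog (\sum_i m i)%N (\prod_i F i ^+ m i).
Proof.
move=> hF; apply: (big_rec2 (fun k p => homog k p)); first exact: dhomog1.
move=> i k p _ hp; apply: dhomogM => //.
by have := dhomogMn (m i) (hF i); rewrite mul1n.
Qed.

Definition lin_subst (U : 'M[R]_n) (p : mpoly n R) : mpoly n R :=
  comp_mpoly [tuple \sum_j U j i *: Xv j | i < n] p.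

Lemma homog_lin_subst U k p : homog k p -> homog k (lin_subst U p).
Proof.
move=> /dhomogP hp; rewrite /lin_subst comp_mpolyE big_seq.
apply: rpred_sum => m mp; apply: rpredZ.
have <- : mdeg m = k := hp m mp.
rewrite mdegE; apply: homog_prodXn => i.
rewrite tnth_mktuple; apply: rpred_sum => j _; apply: rpredZ.
by rewrite dhomogX; apply/eqP; exact: mdeg1.
Qed.

Lemma meval_lin_subst U p (x : 'rV[R]_n) :
  meval (fun i => x 0 i) (lin_subst U p) = meval (fun i => (x *m U) 0 i) p.
Proof.
rewrite /lin_subst comp_mpoly_meval; apply: meval_eq => i.
rewrite tnth_mktuple raddf_sum mxE; apply: eq_bigr => j _ /=.
by rewrite mevalZ mevalXU mulrC.
Qed.

End LinearSubstitution.

Section HarmonicDimension.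
Context {R : realType} {d : nat}.
Implicit Types (p : mpoly d.+2 R) (l : nat).

Local Notation homog k p := (p \is ishomog1 k mdeg).

Definition middle (i : 'I_d) : 'I_d.+2 := lift ord0 (widen_ord (leqnSn d) i).

Lemma sum_middle (m : 'I_d.+2 -> nat) :
  (\sum_i m i = m ord0 + \sum_i m (middle i) + m ord_max)%N.
Proof.
rewrite big_ord_recl big_ord_recr /= addnA; congr (_ + _ + m _)%N.
exact: val_inj.
Qed.

Lemma ord_middleP (i : 'I_d.+2) :
  [\/ i = ord0, exists j, i = middle j | i = ord_max].
Proof.
case: (unliftP ord0 i) => [j ->|->]; last by constructor 1.
have [jd|jd] := ltnP j d; last first.
  constructor 3; apply: val_inj => /=; rewrite /bump /= add1n.
  by congr _.+1; apply/eqP; rewrite eqn_leq jd -ltnS ltn_ord.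
by constructor 2; exists (Ordinal jd); apply: val_inj.
Qed.

(** The exponents, as finite functions, of the monomials of degree [l] which
    have degree at most one in the first variable. *)
Definition cauchy_data l : {set {ffun 'I_d.+2 -> 'I_l.+1}} :=
  [set g : {ffun 'I_d.+2 -> 'I_l.+1} | ((\sum_i g i)%N == l) && (g ord0 <= 1)%N].

(** The last exponent is fixed by the total degree, which leaves two choices
    for the first one and [l + 1] choices for each of the [d] others. *)
Lemma card_cauchy_data l : (#|cauchy_data l| <= 2 * l.+1 ^ d)%N.
Proof.
pose F (g : {ffun 'I_d.+2 -> 'I_l.+1}) : bool * {ffun 'I_d -> 'I_l.+1} :=
  ((g ord0 == 1 :> nat)%N, [ffun i => g (middle i)]).
have Finj : {in cauchy_data l &, injective F}.
  move=> g g'; rewrite !inE => /andP[/eqP gl g1] /andP[/eqP gl' g1'] [e0 em].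
  have E0 : g ord0 = g' ord0 :> nat.
    by move: e0; case: (nat_of_ord (g ord0)) g1 => [|[|//]] _;
       case: (nat_of_ord (g' ord0)) g1' => [|[|//]].
  have Em i : g (middle i) = g' (middle i).
    by have := congr1 (fun h : {ffun 'I_d -> 'I_l.+1} => h i) em; rewrite !ffunE.
  apply/ffunP => i; have [->|[j ->]|->] := ord_middleP i => //; apply: val_inj => //=.
  have := etrans gl (esym gl'); rewrite !sum_middle E0.
  under eq_bigr do rewrite Em.
  by move/addnI.
rewrite -(card_in_imset Finj).
have -> : (2 * l.+1 ^ d)%N = #|{: bool * {ffun 'I_d -> 'I_l.+1}}|.
  by rewrite card_prod card_bool card_ffun !card_ord.
exact: max_card.
Qed.

Definition data_monomial l (g : {ffun 'I_d.+2 -> 'I_l.+1}) : multinom d.+2 :=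
  Multinom [tuple (g i : nat) | i < d.+2].

(** The Laplace equation expresses the second derivative in the first variable
    by the other ones, so it determines a polynomial from its value and first
    derivative on a hyperplane. *)
Lemma harmonic_determined l p : homog l p -> laplacian p = 0 ->
  (forall g, g \in cauchy_data l -> mcoeff (data_monomial g) p = 0) -> p = 0.
Proof.
move=> /homog_coeff hp p0 pg; apply/mpolyP => m; rewrite mcoeff0.
move: {2}(m ord0) (erefl (m ord0)) => k; elim/ltn_ind: k m => k IH m mk.
have [ml|/hp//] := eqVneq (mdeg m) l.
have [k1|k2] := leqP k 1.
  have mlt i : (m i < l.+1)%N.
    by rewrite ltnS -ml mdegE (bigD1 i) //= leq_addr.
  pose g : {ffun 'I_d.+2 -> 'I_l.+1} := [ffun i => inord (m i)].
  have gE i : g i = m i :> nat by rewrite ffunE inordK.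
  have -> : m = data_monomial g.
    by apply/mnmP => i; rewrite multinomE tnth_mktuple gE.
  apply: pg; rewrite inE gE mk k1 andbT; apply/eqP; apply: etrans ml.
  by rewrite mdegE; apply: eq_bigr => i _; rewrite gE.
case: k k2 IH mk => [//|[//|k]] _ IH mk.
pose m' : multinom d.+2 := mnm_sub (mnm_sub m (mnm1 ord0)) (mnm1 ord0).
have m'E : m = mnm_add (mnm_add m' (mnm1 ord0)) (mnm1 ord0).
  apply/mnmP => i; rewrite !mnmDE !mnmBE !mnm1E.
  by case: eqP => [<-|_]; rewrite ?mk /=; lia.
have m'0 : m' ord0 = k by rewrite !mnmBE !mnm1E mk eqxx; lia.
have := congr1 (mcoeff m') p0; rewrite mcoeff0 /laplacian raddf_sum /=.
rewrite (bigD1 ord0) //= big1 => [|i i0].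
  rewrite addr0 !mcoeff_deriv -m'E => /eqP.
  by rewrite -!mulrnA mulrn_eq0 /= => /eqP.
rewrite !mcoeff_deriv (IH k) ?mul0rn // !mnmDE !mnm1E (negbTE i0) m'0 !addn0 //.
Qed.

(** In [d + 2] variables, hence on the sphere of dimension [d + 1], the harmonic
    polynomials of degree [l] form a space whose dimension is of the exact order
    [l ^ d]: the bound loses no power of [l]. *)
Lemma harmonic_dimension l (M : nat) (P : nat -> mpoly d.+2 R) :
  (forall k, (k < M)%N -> homog l (P k) /\ laplacian (P k) = 0) ->
  (forall v : 'I_M -> R, \sum_k v k *: P k = 0 -> forall k, v k = 0) ->
  (M <= 2 * l.+1 ^ d)%N.
Proof.
move=> hP free; apply: leq_trans (card_cauchy_data l).
pose D := cauchy_data l.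
pose A : 'M[R]_(M, #|D|) :=
  \matrix_(k, t) mcoeff (data_monomial (enum_val t)) (P k).
rewrite leqNgt; apply/negP => DM.
have : kermx A != 0.
  by rewrite kermx_eq0 /row_free neq_ltn (leq_ltn_trans (rank_leq_col A)).
case/rowV0Pn => v /sub_kermxP vA; apply/negP; rewrite negbK.
apply/eqP/rowP => k; rewrite mxE.
apply: (free (fun k => v 0 k)) => {k}.
apply: (@harmonic_determined l).
- by apply: rpred_sum => k _; apply: rpredZ; case: (hP k).
- rewrite raddf_sum big1 // => k _ /=; rewrite linearZ /=.
  by case: (hP k) => // _ ->; rewrite scaler0.
- move=> g gD; have := congr1 (fun w : 'rV_#|D| => w 0 (enum_rank_in gD g)) vA.
  rewrite !mxE => vE; rewrite raddf_sum -[RHS]vE; apply: eq_bigr => k _ /=.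
  by rewrite mcoeffZ mxE enum_rankK_in.
Qed.

End HarmonicDimension.

Local Open Scope classical_set_scope.

(** * Continuous functions on the sphere *)

Lemma cvg_sumr (R : realType) (T : Type) (F : set_system T) (FF : Filter F)
    (I : Type) (r : seq I) (P : pred I) (f : I -> T -> R) (a : I -> R) :
  (forall i, P i -> f i x @[x --> F] --> a i) ->
  \sum_(i <- r | P i) f i x @[x --> F] --> \sum_(i <- r | P i) a i.
Proof.
move=> fa; elim: r => [|i r IH].
  by under eq_fun do rewrite big_nil; rewrite big_nil; exact: cvg_cst.
under eq_fun do rewrite big_cons.
by rewrite big_cons; case: ifP => // Pi; apply: cvgD => //; exact: fa.
Qed.

Section SphereTopology.
Context {R : realType} {d : nat}.
Local Notation rV := ('rV[R]_d.+1).
Local Notation S := (@sphere R d).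
Local Notation mS := (@sphere R d : set (borel_space R d)).

Definition dot (x y : rV) : R := \sum_i x 0 i * y 0 i.

Lemma dotC x y : dot x y = dot y x.
Proof. by apply: eq_bigr => i _; rewrite mulrC. Qed.

Lemma dotDl x y z : dot (x + y) z = dot x z + dot y z.
Proof. by rewrite -big_split; apply: eq_bigr => i _; rewrite mxE mulrDl. Qed.

Lemma dotZl a x z : dot (a *: x) z = a * dot x z.
Proof. by rewrite mulr_sumr; apply: eq_bigr => i _; rewrite mxE mulrA. Qed.

Lemma dotNl x z : dot (- x) z = - dot x z.
Proof. by rewrite -scaleN1r dotZl mulN1r. Qed.

Lemma dotBl x y z : dot (x - y) z = dot x z - dot y z.
Proof. by rewrite dotDl dotNl. Qed.

Lemma dotDr x y z : dot z (x + y) = dot z x + dot z y.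
Proof. by rewrite dotC dotDl !(dotC z). Qed.

Lemma dotZr a x z : dot z (a *: x) = a * dot z x.
Proof. by rewrite dotC dotZl (dotC z). Qed.

Lemma dot_ge0 x : 0 <= dot x x.
Proof. by apply: sumr_ge0 => i _; rewrite -expr2 sqr_ge0. Qed.

Lemma dot_eq0 x : (dot x x == 0) = (x == 0).
Proof.
apply/idP/eqP => [|->]; last by rewrite /dot big1 // => i _; rewrite mxE mul0r.
rewrite psumr_eq0 => [/allP x0|i _]; last by rewrite -expr2 sqr_ge0.
apply/rowP => i; rewrite mxE.
by have := x0 i (mem_index_enum i); rewrite mulf_eq0 orbb => /eqP.
Qed.

Lemma enormE x : enorm x = Num.sqrt (dot x x).
Proof. by rewrite /enorm; congr Num.sqrt; apply: eq_bigr => i _; rewrite expr2. Qed.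

Lemma enorm_ge0 (x : rV) : 0 <= enorm x.
Proof. exact: sqrtr_ge0. Qed.

Lemma sphereE x : S x <-> dot x x = 1.
Proof.
rewrite /sphere /= enormE; split => [x1|->]; last exact: sqrtr1.
by rewrite -(sqr_sqrtr (dot_ge0 x)) x1 expr1n.
Qed.

Lemma enormN (x : rV) : enorm (- x) = enorm x.
Proof. by rewrite !enormE dotNl dotC dotNl opprK. Qed.

Lemma dot_continuous (T : topologicalType) (f g : T -> rV) (x : T)
    (F : set_system T) : Filter F -> f @ F --> f x -> g @ F --> g x ->
  dot (f y) (g y) @[y --> F] --> dot (f x) (g x).
Proof.
move=> FF fx gx; rewrite /dot.
apply: cvg_sumr => i _; apply: cvgM.
  apply: (cvg_comp f (fun M : rV => M 0 i) fx); exact: coord_continuous.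
apply: (cvg_comp g (fun M : rV => M 0 i) gx); exact: coord_continuous.
Qed.

Lemma enorm_cvg (T : topologicalType) (f : T -> rV) (x : T)
    (F : set_system T) : Filter F -> f @ F --> f x ->
  enorm (f y) @[y --> F] --> enorm (f x).
Proof.
move=> FF fx.
have -> : (fun y => enorm (f y)) = Num.sqrt \o (fun y => dot (f y) (f y)).
  by apply/funext => y /=; rewrite enormE.
rewrite enormE.
exact: (cvg_comp _ _ (dot_continuous FF fx fx) (@sqrt_continuous _ _)).
Qed.

Lemma rV_continuous (T : topologicalType) (f : T -> rV) :
  (forall i, continuous (fun x => f x 0 i)) -> continuous f.
Proof.
move=> fc x; apply/cvg_ballP => e e0.
have : \forall y \near x, forall i, ball (f x 0 i) e (f y 0 i).
  by apply: filter_forall => i; have /cvg_ballP := fc i x; apply.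
by apply: filterS => y yb; split => // i j; rewrite (ord1 i).
Qed.

Lemma mulmxr_continuous (U : 'M[R]_d.+1) : continuous (fun x : rV => x *m U).
Proof.
apply: rV_continuous => i x.
rewrite (_ : (fun _ => _) = (fun y : rV => \sum_j y 0 j * U j i)); last first.
  by apply/funext => y; rewrite mxE.
apply: (@cvg_sumr _ _ (nbhs x)) => j _; apply: cvgMl; exact: coord_continuous.
Qed.

Lemma closed_sphere : closed S.
Proof.
rewrite (_ : S = (fun x : rV => dot x x) @^-1` [set 1]).
  apply: closed_comp => [x _|]; last exact: (@closed_eq R 1).
  exact: (@dot_continuous _ id id x (nbhs x) _ cvg_id cvg_id).
by apply/seteqP; split => x /sphereE.
Qed.

Lemma compact_sphere : compact S.
Proof.
apply: bounded_closed_compact; last exact: closed_sphere.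
exists 1; split; first exact: real1.
move=> M M1 x /sphereE x1; rewrite /= [leLHS]/Num.norm /= mx_normrE.
apply/bigmax_leP; split; first by rewrite (le_trans _ (ltW M1)).
move=> [i j] _ /=; rewrite ord1; apply: le_trans (ltW M1).
rewrite -(expr_le1 (n := 2)) // real_normK ?num_real // -x1.
rewrite /dot (bigD1 j) //= -expr2 lerDl.
by apply: sumr_ge0 => k _; rewrite -expr2 sqr_ge0.
Qed.

Lemma open_borel (A : set rV) : open A -> measurable (A : set (borel_space R d)).
Proof. by move=> oA; apply: sub_sigma_algebra. Qed.

Lemma measurable_sphere : measurable mS.
Proof.
rewrite -[mS]setCK; apply: measurableC; apply: open_borel.
by apply: closed_openC; exact: closed_sphere.
Qed.

Lemma mulmxr_measurable (U : 'M[R]_d.+1) :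
  measurable_fun setT (fun x : borel_space R d => (x : rV) *m U : borel_space R d).
Proof.
apply: (@measurability _ _ (borel_space R d) (borel_space R d) _ _ (@open rV)) => //.
move=> _ [A oA <-]; rewrite setTI; apply: open_borel.
move: A oA; exact/continuousP/mulmxr_continuous.
Qed.

(** Continuity on the sphere is the regularity of all the explicit functions
    below: it is stable under the algebraic operations and, the sphere being
    compact, it gives boundedness and integrability at once.  It is sealed as
    an inductive predicate so that unification does not unfold it into a
    statement on neighbourhood filters. *)
Variant scont (u : rV -> R) : Prop := Scont of {within S, continuous u}.

Lemma scontP u : scont u <-> forall x, S x -> u @ within S (nbhs x) --> u x.
Proof.
by split=> [[/subspace_continuousP]|uc] //; split; apply/subspace_continuousP.
Qed.

Lemma eq_scont u v : (forall x, S x -> u x = v x) -> scont u -> scont v.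
Proof.
move=> uv [uc]; split.
by apply: subspace_eq_continuous uc => x /set_mem; exact: uv.
Qed.

Lemma scontD u v : scont u -> scont v -> scont (fun x => u x + v x).
Proof. by move=> /scontP uc /scontP vc; apply/scontP => x Sx; apply: cvgD; auto. Qed.

Lemma scontM u v : scont u -> scont v -> scont (fun x => u x * v x).
Proof. by move=> /scontP uc /scontP vc; apply/scontP => x Sx; apply: cvgM; auto. Qed.

Lemma scont_cst c : scont (fun=> c).
Proof. by apply/scontP => x Sx; apply: cvg_cst. Qed.

Lemma scontZ c u : scont u -> scont (fun x => c * u x).
Proof. by move=> uc; apply: scontM => //; exact: scont_cst. Qed.

Lemma scontB u v : scont u -> scont v -> scont (fun x => u x - v x).
Proof. by move=> /scontP uc /scontP vc; apply/scontP => x Sx; apply: cvgB; auto. Qed.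

Lemma scont_sum I (r : seq I) (P : pred I) (F : I -> rV -> R) :
  (forall i, P i -> scont (F i)) -> scont (fun x => \sum_(i <- r | P i) F i x).
Proof.
move=> Fc; elim: r => [|i r IH].
  by apply: eq_scont (scont_cst 0) => x _; rewrite big_nil.
have [Pi|Pi] := boolP (P i); last first.
  by apply: eq_scont IH => x _; rewrite big_cons (negbTE Pi).
by apply: eq_scont (scontD (Fc i Pi) IH) => x _; rewrite big_cons Pi.
Qed.

Lemma continuous_scont u : continuous (u : rV -> R) -> scont u.
Proof. by move=> uc; split; exact: continuous_subspaceT. Qed.

Lemma scont_comp u (g : rV -> rV) : continuous g -> (forall x, S x -> S (g x)) ->
  scont u -> scont (u \o g).
Proof.
move=> gc gS /scontP uc; apply/scontP => x Sx.
apply: cvg_comp (uc _ (gS _ Sx)) => A /= wA.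
move: (gc x _ wA); apply: (@filterS _ (nbhs x)) => y Ay Sy.
exact: Ay (gS _ Sy).
Qed.

Lemma scont_measurable u : scont u -> measurable_fun mS u.
Proof.
move=> [uc]; apply: (measurability _ (RGenOpens.measurableE R)) => //.
move=> _ [_ [a [b ->] <-]].
have oab : open `]a, b[%classic by exact: interval_open.
move/continuousP : uc => /(_ _ oab)/open_subspaceP[V oV VE].
rewrite setIC -VE; apply: measurableI; [exact: open_borel|exact: measurable_sphere].
Qed.

Lemma scont_bounded u : scont u -> exists2 M, 0 < M & forall x, S x -> `|u x| <= M.
Proof.
move=> [uc]; have /compact_bounded[M [_ HM]] := continuous_compact uc compact_sphere.
exists (`|M| + 1); first by rewrite ltr_wpDl.
move=> x Sx; apply: HM; last by exists x.
by rewrite (le_lt_trans (ler_norm _)) // ltrDl.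
Qed.

End SphereTopology.

(** * Square-integrable functions on the sphere *)

Section SquareIntegrable.
Context {R : realType} {d : nat} (mu : probability (borel_space R d) R).
Local Notation rV := ('rV[R]_d.+1).
Local Notation S := (@sphere R d).
Local Notation mS := (@sphere R d : set (borel_space R d)).
Implicit Types u v w : rV -> R.

Definition sintegrable u : Prop :=
  mu.-integrable mS (EFin \o (u : borel_space R d -> R)).

Variant sqint u : Prop :=
  Sqint of measurable_fun mS u & sintegrable (fun x => u x ^+ 2).

Lemma sphere_finite : (mu mS < +oo)%E.
Proof. by rewrite (le_lt_trans (probability_le1 _ measurable_sphere)) ?ltry. Qed.

Lemma le_sintegrable u v : measurable_fun mS u ->
  (forall x, S x -> `|u x| <= v x) -> sintegrable v -> sintegrable u.
Proof.
move=> mu_ uv; apply: le_integrable => //; first exact: measurable_sphere.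
  exact/measurable_EFinP.
by move=> x Sx /=; rewrite lee_fin (le_trans (uv _ Sx)) ?ler_norm.
Qed.

Lemma eq_sintegrable u v : (forall x, S x -> u x = v x) ->
  sintegrable u -> sintegrable v.
Proof.
move=> uv; apply: eq_integrable; first exact: measurable_sphere.
by move=> x /set_mem Sx /=; rewrite uv.
Qed.

Lemma sintegrableD u v : sintegrable u -> sintegrable v ->
  sintegrable (fun x => u x + v x).
Proof.
move=> iu iv; have := integrableD measurable_sphere iu iv.
by apply: eq_integrable; [exact: measurable_sphere|move=> x _ /=; rewrite EFinD].
Qed.

Lemma sintegrableZ c u : sintegrable u -> sintegrable (fun x => c * u x).
Proof.
move=> iu; have := integrableZl measurable_sphere c iu.
by apply: eq_integrable; [exact: measurable_sphere|move=> x _ /=; rewrite EFinM].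
Qed.

Lemma sqint_integrableM u v : sqint u -> sqint v ->
  sintegrable (fun x => u x * v x).
Proof.
move=> [mu_ iu] [mv iv]; apply: le_sintegrable (sintegrableD iu iv).
  exact: measurable_funM.
move=> x _; rewrite ler_norml; have := sqr_ge0 (u x + v x).
by have := sqr_ge0 (u x - v x); have := sqr_ge0 (u x); have := sqr_ge0 (v x); nra.
Qed.

Lemma eq_sqint u v : (forall x, S x -> u x = v x) -> sqint u -> sqint v.
Proof.
move=> uv [mu_ iu]; split.
  by apply: eq_measurable_fun mu_ => x /set_mem; exact: uv.
by apply: eq_sintegrable iu => x Sx; rewrite uv.
Qed.

Lemma sqintD u v : sqint u -> sqint v -> sqint (fun x => u x + v x).
Proof.
move=> hu hv; case: (hu) (hv) => [mu_ iu] [mv iv]; split.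
  exact: measurable_funD.
have iuv := sintegrableZ 2 (sqint_integrableM hu hv).
apply: eq_sintegrable (sintegrableD (sintegrableD iu iv) iuv) => x _; ring.
Qed.

Lemma sqint_bounded (b u : rV -> R) (M : R) : measurable_fun mS b ->
  (forall x, S x -> `|b x| <= M) -> sqint u -> sqint (fun x => b x * u x).
Proof.
move=> mb bM [mu_ iu]; split; first exact: measurable_funM.
apply: le_sintegrable (sintegrableZ (M ^+ 2) iu).
  by apply: measurable_funX; exact: measurable_funM.
move=> x Sx; rewrite ger0_norm ?sqr_ge0 // exprMn ler_wpM2r ?sqr_ge0 //.
rewrite -(@real_normK _ (b x)) ?num_real // lerXn2r ?nnegrE ?bM //.
exact: le_trans (bM _ Sx).
Qed.

Lemma sqint_cst c : sqint (fun=> c).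
Proof.
split; first exact: measurable_cst.
apply: measurable_bounded_integrable; [exact: measurable_sphere|
  exact: sphere_finite|exact: measurable_cst|].
exists (c ^+ 2); split => [|M cM x _ /=]; first exact: num_real.
by rewrite ger0_norm ?sqr_ge0 // ltW.
Qed.

Lemma sqint_scontM u v : scont u -> sqint v -> sqint (fun x => u x * v x).
Proof.
move=> uc; have [M _ uM] := scont_bounded uc.
by apply: sqint_bounded uM; exact: scont_measurable.
Qed.

Lemma sqint_scont u : scont u -> sqint u.
Proof.
move=> uc; apply: eq_sqint (sqint_scontM uc (sqint_cst 1)) => x _.
by rewrite mulr1.
Qed.

Lemma sqintZ c u : sqint u -> sqint (fun x => c * u x).
Proof. by apply: sqint_scontM; exact: scont_cst. Qed.

Lemma sqintB u v : sqint u -> sqint v -> sqint (fun x => u x - v x).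
Proof.
move=> hu hv; apply: eq_sqint (sqintD hu (sqintZ (-1) hv)) => x _.
by rewrite mulN1r.
Qed.

Lemma sqint_sum I (r : seq I) (P : pred I) (F : I -> rV -> R) :
  (forall i, P i -> sqint (F i)) -> sqint (fun x => \sum_(i <- r | P i) F i x).
Proof.
move=> Fc; elim: r => [|i r IH].
  by apply: eq_sqint (sqint_cst 0) => x _; rewrite big_nil.
have [Pi|Pi] := boolP (P i); last first.
  by apply: eq_sqint IH => x _; rewrite big_cons (negbTE Pi).
by apply: eq_sqint (sqintD (Fc i Pi) IH) => x _; rewrite big_cons Pi.
Qed.

Lemma sintegrable_scont u : scont u -> sintegrable u.
Proof.
move=> uc; apply: eq_sintegrable (sqint_integrableM (sqint_scont uc) (sqint_cst 1)).
by move=> x _; rewrite mulr1.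
Qed.

Lemma eq_sint u v : (forall x, S x -> u x = v x) -> sint mu u = sint mu v.
Proof. by move=> uv; apply: eq_Rintegral => x /set_mem; exact: uv. Qed.

Lemma sintD u v : sintegrable u -> sintegrable v ->
  sint mu (fun x => u x + v x) = sint mu u + sint mu v.
Proof. by move=> iu iv; apply: RintegralD => //; exact: measurable_sphere. Qed.

Lemma sintZ c u : sintegrable u -> sint mu (fun x => c * u x) = c * sint mu u.
Proof. by move=> iu; apply: RintegralZl => //; exact: measurable_sphere. Qed.

Definition ip u v : R := sint mu (fun x => u x * v x).

Lemma ipC u v : ip u v = ip v u.
Proof. by apply: eq_sint => x _; rewrite mulrC. Qed.

Lemma eq_ip u u' v v' : (forall x, S x -> u x = u' x) ->
  (forall x, S x -> v x = v' x) -> ip u v = ip u' v'.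
Proof. by move=> uu vv; apply: eq_sint => x Sx; rewrite uu // vv. Qed.

Lemma ipDr u v w : sqint u -> sqint v -> sqint w ->
  ip u (fun x => v x + w x) = ip u v + ip u w.
Proof.
move=> hu hv hw; rewrite /ip -sintD; try exact: sqint_integrableM.
by apply: eq_sint => x _; rewrite mulrDr.
Qed.

Lemma ipZr c u v : sqint u -> sqint v -> ip u (fun x => c * v x) = c * ip u v.
Proof.
move=> hu hv; rewrite /ip -sintZ; last exact: sqint_integrableM.
by apply: eq_sint => x _; rewrite mulrCA.
Qed.

Lemma ip0r u : ip u (fun=> 0) = 0.
Proof.
rewrite /ip /sint; under eq_Rintegral do rewrite mulr0.
by rewrite Rintegral_cst ?mul0r //; exact: measurable_sphere.
Qed.

Lemma ipDl u v w : sqint u -> sqint v -> sqint w ->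
  ip (fun x => v x + w x) u = ip v u + ip w u.
Proof. by move=> *; rewrite ipC ipDr // !(ipC u). Qed.

Lemma ipZl c u v : sqint u -> sqint v -> ip (fun x => c * v x) u = c * ip v u.
Proof. by move=> *; rewrite ipC ipZr // (ipC u). Qed.

Lemma ipBl u v w : sqint u -> sqint v -> sqint w ->
  ip (fun x => v x - w x) u = ip v u - ip w u.
Proof.
move=> hu hv hw; rewrite -mulN1r -ipZl // -ipDl //; last exact: sqintZ.
by apply: eq_ip => // x _; rewrite mulN1r.
Qed.

Lemma ip_sumr I (r : seq I) (P : pred I) u (F : I -> rV -> R) : sqint u ->
  (forall i, P i -> sqint (F i)) ->
  ip u (fun x => \sum_(i <- r | P i) F i x) = \sum_(i <- r | P i) ip u (F i).
Proof.
move=> hu hF; elim: r => [|i r IH].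
  by rewrite big_nil -[RHS](ip0r u); apply: eq_ip => // x _; rewrite big_nil.
rewrite big_cons; have [Pi|Pi] := boolP (P i); last first.
  by rewrite -IH; apply: eq_ip => // x _; rewrite big_cons (negbTE Pi).
rewrite -IH -ipDr //; try exact: hF; try exact: sqint_sum.
by apply: eq_ip => // x _; rewrite big_cons Pi.
Qed.

Lemma ip_ge0 u : 0 <= ip u u.
Proof. by apply: Rintegral_ge0 => x _; rewrite -expr2 sqr_ge0. Qed.

Lemma le_ip u v c : sqint u -> sqint v ->
  (forall x, S x -> u x ^+ 2 <= c * v x ^+ 2) -> ip u u <= c * ip v v.
Proof.
move=> hu hv uv; rewrite -ipZr //; apply: le_Rintegral.
- exact: measurable_sphere.
- exact: sqint_integrableM.
- by apply: sqint_integrableM => //; exact: sqintZ.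
- by move=> x Sx; rewrite -expr2 mulrCA -expr2; exact: uv.
Qed.

Lemma ip_sub2 u v : sqint u -> sqint v ->
  ip (fun x => u x - v x) (fun x => u x - v x) = ip u u - 2 * ip u v + ip v v.
Proof.
move=> hu hv; rewrite ipBl //; last exact: sqintB.
by rewrite ![ip _ (fun=> _ - _)]ipC !ipBl // (ipC v u); ring.
Qed.

Lemma ip_addle u v : sqint u -> sqint v ->
  ip (fun x => u x + v x) (fun x => u x + v x) <= 2 * ip u u + 2 * ip v v.
Proof.
move=> hu hv; have := ip_ge0 (fun x => u x - v x); rewrite ip_sub2 //.
have huv := sqintD hu hv.
by rewrite ipDl // !(ipC _ (fun=> _ + _)) !ipDl // (ipC v u); lra.
Qed.

End SquareIntegrable.

(** * Rotations *)

Section LineReflection.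
Context {R : realType} {d : nat}.
Local Notation rV := ('rV[R]_d.+1).
Local Notation S := (@sphere R d).
Implicit Types x y v z : rV.

Lemma dotE x y : dot x y = (x *m y^T) 0 0.
Proof. by rewrite mxE; apply: eq_bigr => i _; rewrite mxE. Qed.

Lemma dot_orthogonal (U : 'M[R]_d.+1) x y : U *m U^T = 1%:M ->
  dot (x *m U) (y *m U) = dot x y.
Proof. by move=> UU; rewrite !dotE trmx_mul mulmxA -(mulmxA x) UU mulmx1. Qed.

Lemma rotation_sphere (U : 'M[R]_d.+1) x : is_rotation U -> S x -> S (x *m U).
Proof. by move=> [UU _] /sphereE x1; apply/sphereE; rewrite dot_orthogonal. Qed.

Lemma is_rotationT (U : 'M[R]_d.+1) : is_rotation U -> is_rotation U^T.
Proof. by move=> [UU dU]; split; rewrite ?trmxK ?det_tr //; exact: mulmx1C. Qed.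

(** The orthogonal reflection through the line spanned by [v]. *)
Definition line_reflection v : 'M[R]_d.+1 :=
  (2 / dot v v) *: (v^T *m v) - 1%:M.

Lemma line_reflectionE v x :
  x *m line_reflection v = (2 / dot v v * dot x v) *: v - x.
Proof.
rewrite mulmxBr mulmx1 -scalemxAr mulmxA; congr (_ - _).
rewrite -scalerA; congr (_ *: _); rewrite dotE.
by rewrite {1}[x *m v^T]mx11_scalar mul_scalar_mx.
Qed.

Lemma line_reflection_sym v : (line_reflection v)^T = line_reflection v.
Proof. by rewrite linearB /= linearZ /= trmx1 trmx_mul trmxK. Qed.

Lemma line_reflectionK v : v != 0 ->
  line_reflection v *m line_reflection v = 1%:M.
Proof.
move=> v0; have vv0 : dot v v != 0 by rewrite dot_eq0.
apply/row_matrixP => i; rewrite !rowE mulmxA mulmx1.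
move: (delta_mx 0 i : rV) => x.
rewrite !line_reflectionE dotBl dotZl opprB addrA addrAC -scalerBl.
rewrite (_ : _ - _ = 0) ?scale0r ?add0r //.
by field.
Qed.

Lemma square_rotation (A : 'M[R]_d.+1) : A *m A^T = 1%:M -> is_rotation (A *m A).
Proof.
move=> AA; split; first by rewrite trmx_mul mulmxA -(mulmxA A A) AA mulmx1.
by have := congr1 determinant AA; rewrite !det_mulmx det_tr det1.
Qed.

Lemma normalize_sphere v : v != 0 -> S ((enorm v)^-1 *: v).
Proof.
move=> v0; apply/sphereE; rewrite dotZl dotZr enormE mulrA -expr2 exprVn.
by rewrite sqr_sqrtr ?dot_ge0 // mulVf // dot_eq0.
Qed.

(** Some basis vector is not a multiple of [x], and its component orthogonal
    to [x] can be normalized. *)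
Lemma orthogonal_unit x : (0 < d)%N -> S x -> exists2 z, S z & dot z x = 0.
Proof.
move=> d0 /sphereE x1.
have [j xj] : exists j, x 0 j ^+ 2 != 1.
  apply/existsP; rewrite -negb_forall; apply/negP => /forallP xj.
  have : dot x x = d.+1%:R.
    rewrite -[d.+1 in RHS]card_ord -sumr_const; apply: eq_bigr => j _.
    by rewrite -expr2; exact/eqP.
  by rewrite x1 => /eqP; rewrite eq_sym pnatr_eq1 eqSS; case: (d) d0.
pose e : rV := delta_mx 0 j.
have ex : dot e x = x 0 j.
  rewrite /dot (bigD1 j) //= big1 ?mxE ?eqxx ?mul1r ?addr0 // => i ij.
  by rewrite mxE (negbTE ij) andbF mul0r.
pose v := e - x 0 j *: x.
have vx : dot v x = 0 by rewrite dotBl dotZl ex x1 mulr1 subrr.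
have v0 : v != 0.
  apply: contra_neq xj => v0; move: (ex); rewrite -[e](subrK (x 0 j *: x)) -/v v0.
  rewrite add0r => _; have := congr1 (fun w : rV => w 0 j) v0.
  by rewrite !mxE !eqxx /= -expr2 => /eqP; rewrite subr_eq0 => /eqP <-.
exists ((enorm v)^-1 *: v); first exact: normalize_sphere.
by rewrite dotZl vx mulr0.
Qed.

(** The rotation is the square of a half-way rotation [A], so that its
    determinant need not be computed: [A] takes [x] to a midpoint [z] and [z]
    to [y], and is a product of two line reflections. *)
Lemma rotation_transitive x y : (0 < d)%N -> S x -> S y ->
  exists2 U : 'M[R]_d.+1, is_rotation U & x *m U = y.
Proof.
move=> d0 Sx Sy; move: (Sx) (Sy) => /sphereE x1 /sphereE y1.
have [z [/sphereE z1 zx0 zE]] :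
    exists z, [/\ S z, 0 <= dot z x & (2 * dot z x) *: z - x = y].
  have [xy0|xy0] := eqVneq (x + y) 0.
    have [z Sz zx] := orthogonal_unit d0 Sx.
    exists z; rewrite zx mulr0 scale0r sub0r; split => //.
    by apply/eqP; rewrite eq_sym -addr_eq0 addrC; exact/eqP.
  exists ((enorm (x + y))^-1 *: (x + y)).
  have nxy : dot (x + y) (x + y) = 2 * dot (x + y) x.
    by rewrite !dotDl !dotDr x1 y1 (dotC x y); ring.
  have n0 : dot (x + y) (x + y) != 0 by rewrite dot_eq0.
  split; first exact: normalize_sphere.
    rewrite dotZl mulr_ge0 ?invr_ge0 ?enorm_ge0 //.
    by have := dot_ge0 (x + y); rewrite nxy pmulr_rge0.
  rewrite dotZl scalerA mulrCA -nxy mulrAC -invfM -expr2 enormE.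
  by rewrite sqr_sqrtr ?dot_ge0 // mulVf // scale1r addrC addKr.
have xz0 : x + z != 0.
  by rewrite -dot_eq0 !dotDl !dotDr x1 z1 (dotC x z) gt_eqF //; lra.
have x0 : x != 0 by rewrite -dot_eq0 x1 oner_eq0.
pose A := line_reflection x *m line_reflection (x + z).
exists (A *m A).
  apply: square_rotation; rewrite trmx_mul !line_reflection_sym mulmxA.
  by rewrite -(mulmxA (line_reflection x)) !line_reflectionK // mulmx1 line_reflectionK.
have xx : x *m line_reflection x = x.
  by rewrite line_reflectionE x1 divr1 mulr1 scaler_nat mulr2n addrK.
have c1 : dot (x + z) (x + z) = 2 * (1 + dot z x).
  by rewrite !dotDl !dotDr x1 z1 (dotC x z); ring.
have xzS : 1 + dot z x != 0 by rewrite gt_eqF //; lra.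
have xAz : x *m line_reflection (x + z) = z.
  rewrite line_reflectionE c1 dotDr x1 (dotC x z).
  rewrite (_ : _ * _ = 1); last by field; rewrite xzS.
  by rewrite scale1r addrC addKr.
have zAx : z *m line_reflection (x + z) = x.
  by rewrite -{1}xAz -mulmxA line_reflectionK // mulmx1.
rewrite /A !mulmxA xx xAz (line_reflectionE x z) x1 divr1 mulmxBl -scalemxAl xAz zAx.
by rewrite -zE.
Qed.

End LineReflection.

Section RotationInvariance.
Context {R : realType} {d : nat} (mu : probability (borel_space R d) R).
Hypothesis hmu : rotation_invariant mu.
Local Notation rV := ('rV[R]_d.+1).
Local Notation S := (@sphere R d).
Local Notation mS := (@sphere R d : set (borel_space R d)).
Implicit Types u v : rV -> R.

Lemma sint_cst c : sint mu (fun=> c) = c.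
Proof.
rewrite /sint Rintegral_cst; last exact: measurable_sphere.
by apply: etrans (mulr1 c); congr (_ * _); exact: (congr1 (@fine R) hmu.1).
Qed.

Lemma scont_rotation (U : 'M[R]_d.+1) u : is_rotation U -> scont u ->
  scont (fun x => u (x *m U)).
Proof.
move=> hU; apply: (scont_comp (g := fun x => x *m U)).
  exact: mulmxr_continuous.
by move=> x; exact: rotation_sphere.
Qed.

Lemma sint_rotation (U : 'M[R]_d.+1) u : is_rotation U -> scont u ->
  sint mu (fun x => u (x *m U)) = sint mu u.
Proof.
move=> hU uc; have [M M0 uM] := scont_bounded uc.
(* Adding a constant makes the function nonnegative on the sphere, as the
   change of variables below requires. *)
pose v x := u x + M.
have v0 x : S x -> 0 <= v x.
  by move=> Sx; have := uM x Sx; rewrite ler_norml /v => /andP[]; lra.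
have vc : scont v by apply: scontD => //; exact: scont_cst.
have uUc := scont_rotation hU uc.
suff vU : sint mu (fun x => v (x *m U)) = sint mu v.
  apply: (@addIr _ M); rewrite -[in X in _ + X = _](sint_cst M).
  rewrite -[in X in _ = _ + X](sint_cst M) -!sintD //; try exact: sintegrable_scont.
  - by apply: sintegrable_scont; exact: scont_cst.
  - by apply: sintegrable_scont; exact: scont_cst.
pose T (x : borel_space R d) : borel_space R d := (x : rV) *m U.
have mT : measurable_fun setT T := mulmxr_measurable U.
have TS : T @^-1` mS = mS.
  apply/seteqP; split => x /=; last exact: rotation_sphere.
  move=> /(rotation_sphere (is_rotationT hU)).
  by rewrite /T -mulmxA; case: hU => -> _; rewrite mulmx1.
have mv : measurable_fun mS (EFin \o (v : borel_space R d -> R)).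
  by apply/measurable_EFinP; exact: scont_measurable.
have v0' : {in mS, forall y, (0 <= (EFin \o (v : borel_space R d -> R)) y)%E}.
  by move=> y /set_mem Sy; rewrite lee_fin v0.
have := @ge0_integral_pushforward _ _ _ _ _ T mT mu mS _ measurable_sphere mv v0'.
rewrite TS /sint /Rintegral => <-; congr fine.
pose mT_mixin := isMeasurableFun.Build _ _ _ _ _ mT.
pose T' : {mfun borel_space R d >-> borel_space R d} := HB.pack T mT_mixin.
apply: (@eq_measure_integral _ _ _ mS mu (pushforward mu T')) => A mA _.
by rewrite /pushforward; exact: (hmu.2 U hU A mA).
Qed.

(** Caps are cut out by the Euclidean distance, as the balls of the sup norm
    are not permuted by rotations. *)
Definition cap (y : rV) (e : R) : set rV := [set x | dot (x - y) (x - y) < e].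

Lemma open_cap y e : open (cap y e).
Proof.
have c : continuous (fun x : rV => dot (x - y) (x - y)).
  move=> x; have xc : (fun x0 => x0 - y) @ nbhs x --> x - y.
    by apply: cvgB; [exact: cvg_id|exact: cvg_cst].
  exact: (@dot_continuous _ _ _ (fun x0 : rV => x0 - y) (fun x0 : rV => x0 - y) x (nbhs x) _ xc xc).
rewrite (_ : cap y e = (fun x : rV => dot (x - y) (x - y)) @^-1` [set r | r < e]) //.
by apply: open_comp => [x _|]; [exact: c|exact: open_lt].
Qed.

Lemma measure_cap x y e : (0 < d)%N -> S x -> S y ->
  mu (cap x e : set (borel_space R d)) = mu (cap y e : set (borel_space R d)).
Proof.
move=> d0 Sx Sy; have [U hU xUy] := rotation_transitive d0 Sx Sy.
rewrite -(hmu.2 U hU _ (open_borel (@open_cap y e))); congr (mu _).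
apply/seteqP; split => z; rewrite /cap /= -xUy -mulmxBl dot_orthogonal //;
  by case: hU.
Qed.

(** A rotation invariant measure charges every cap: otherwise, all caps of
    the same radius being null, the compact sphere would be null. *)
Lemma cap_charged x e : (0 < d)%N -> S x -> 0 < e ->
  mu (cap x e : set (borel_space R d)) != 0%E.
Proof.
move=> d0 Sx e0; apply/negP => /eqP cap0.
have := compact_sphere (R := R) (d := d); rewrite compact_cover.
move=> /(_ _ S (fun y => cap y e) (fun y _ => @open_cap y e)) [].
  move=> y Sy; exists y => //; rewrite /cap /= subrr.
  by have /eqP -> : dot (0 : rV) 0 == 0 by rewrite dot_eq0.
move=> D DS cov.
have : mu.-negligible mS.
  apply: (@negligibleS _ (borel_space R d) R mu _ _ cov); rewrite /cover bigcup_fset.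
  rewrite big_seq; apply: (big_ind (fun A => mu.-negligible (A : set (borel_space R d)))).
  - exact: negligible_set0.
  - by move=> A B nA nB; exact: negligibleU.
  - move=> y yD; apply/negligibleP; first exact: (@open_borel R d _ (@open_cap _ _)).
    by apply: etrans (measure_cap e d0 _ Sx) cap0; apply/set_mem; exact: DS.
move/negligibleP => /(_ measurable_sphere) S0.
by have := etrans (esym hmu.1) S0 => /eqP; rewrite onee_eq0.
Qed.

(** Two continuous functions which differ at a point differ on a cap. *)
Lemma scont_ae_eq u v : (0 < d)%N -> scont u -> scont v ->
  {ae mu, forall x : borel_space R d, S x -> u x = v x} ->
  forall x, S x -> u x = v x.
Proof.
move=> d0 uc vc [N [mN N0 uvN]] x Sx; apply/eqP; rewrite -subr_eq0.
apply/negPn/negP => uvx.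
have /scontP/(_ x Sx) := scontB uc vc; move=> wc.
have : \forall y \near within S (nbhs x), u y - v y != 0.
  apply: (wc [set r | r != 0]); apply: open_nbhs_nbhs; split; [exact: open_neq|exact: uvx].
rewrite /within /= => /nbhs_ballP[e e0 xe].
have e0' : 0 < e := e0.
have capN : cap x (e ^+ 2) `&` mS `<=` N.
  move=> y [ye Sy]; apply: uvN => /(_ Sy) uvy.
  have /xe/(_ Sy) : ball x e y.
    split=> [|i j]; [exact: e0|rewrite (ord1 i) -ball_normE /ball_ /=].
    rewrite distrC -(ltr_pXn2r (n := 2)) ?nnegrE ?(ltW e0') // real_normK ?num_real //.
    apply: le_lt_trans ye; rewrite /dot (bigD1 j) //= !mxE -expr2 lerDl.
    by apply: sumr_ge0 => k _; rewrite -expr2 sqr_ge0.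
  by rewrite uvy subrr eqxx.
have /eqP := cap_charged d0 Sx (exprn_gt0 2 e0); apply.
apply/negligibleP; first exact: (@open_borel R d _ (@open_cap _ _)).
apply: (@negligibleS _ _ _ _ (N `|` ~` mS)).
  move=> y ye; have [Sy|Sy] := pselect (S y); last by right.
  by left; apply: capN.
apply: negligibleU; first by exists N; split.
apply/negligibleP; first exact: (measurableC (@measurable_sphere R d)).
apply: etrans (probability_setC mu (@measurable_sphere R d)) _.
by rewrite (_ : mu mS = 1%E) ?subee //; exact: hmu.1.
Qed.

End RotationInvariance.

(** * Spherical harmonics *)

Lemma leq_harmonic_dimension {R : realType} {d : nat} l (M : nat)
    (P : nat -> mpoly d.+1 R) : (0 < d)%N ->
  (forall k, (k < M)%N -> P k \is ishomog1 l mdeg /\ laplacian (P k) = 0) ->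
  (forall v : 'I_M -> R, \sum_k v k *: P k = 0 -> forall k, v k = 0) ->
  (M <= 2 * l.+1 ^ d.-1)%N.
Proof. by case: d P => // d P _; exact: harmonic_dimension. Qed.

Section DoubleSum.
Context {R : realType} (Z : nat -> nat).
Implicit Types (F G : nat -> nat -> R) (n : nat).

(** Sums over the index set of the basis functions of degree less than [n]. *)
Definition dsum n F : R := \sum_(l < n) \sum_(k < Z l) F l k.

Lemma eq_dsum n F G : (forall l k, (l < n)%N -> (k < Z l)%N -> F l k = G l k) ->
  dsum n F = dsum n G.
Proof.
by move=> FG; apply: eq_bigr => l _; apply: eq_bigr => k _; exact: FG.
Qed.

Lemma ler_dsum n F G :
  (forall l k, (l < n)%N -> (k < Z l)%N -> F l k <= G l k) ->
  dsum n F <= dsum n G.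
Proof.
by move=> FG; apply: ler_sum => l _; apply: ler_sum => k _; exact: FG.
Qed.

Lemma dsum_ge0 n F : (forall l k, (l < n)%N -> (k < Z l)%N -> 0 <= F l k) ->
  0 <= dsum n F.
Proof.
by move=> FG; apply: sumr_ge0 => l _; apply: sumr_ge0 => k _; exact: FG.
Qed.

Lemma dsumD n F G : dsum n (fun l k => F l k + G l k) = dsum n F + dsum n G.
Proof. by rewrite -big_split; apply: eq_bigr => l _; rewrite -big_split. Qed.

Lemma dsumZ n c F : dsum n (fun l k => c * F l k) = c * dsum n F.
Proof. by rewrite mulr_sumr; apply: eq_bigr => l _; rewrite mulr_sumr. Qed.

Lemma dsumS n F : dsum n.+1 F = dsum n F + \sum_(k < Z n) F n k.
Proof. by rewrite /dsum big_ord_recr. Qed.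

Lemma dsum_le n m F : (n <= m)%N -> (forall l k, (k < Z l)%N -> 0 <= F l k) ->
  dsum n F <= dsum m F.
Proof.
move=> nm F0; elim: m nm => [|m IH]; first by rewrite leqn0 => /eqP ->.
rewrite leq_eqVlt => /predU1P[-> //|]; rewrite ltnS => /IH /le_trans; apply.
by rewrite dsumS lerDl; apply: sumr_ge0 => k _; exact: F0.
Qed.

Lemma dsum_widen n m F : (n <= m)%N ->
  dsum n F = dsum m (fun l k => if (l < n)%N then F l k else 0).
Proof.
move=> nm; rewrite /dsum (big_ord_widen m (fun l => \sum_(k < Z l) F l k) nm).
rewrite big_mkcond /=; apply: eq_bigr => l _.
by case: ifP => // _; rewrite big1.
Qed.

Lemma dsum_cauchy_schwarz n F G :
  dsum n (fun l k => F l k * G l k) ^+ 2 <=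
  dsum n (fun l k => F l k ^+ 2) * dsum n (fun l k => G l k ^+ 2).
Proof.
set P := dsum n (fun l k => F l k * G l k); set A := dsum n _; set Q := dsum n _.
have quad t : 0 <= A + (- 2 * t * P + t ^+ 2 * Q).
  rewrite /A /P /Q -!dsumZ -!dsumD; apply: dsum_ge0 => l k _ _.
  rewrite (_ : _ + _ = (F l k - t * G l k) ^+ 2) ?sqr_ge0 //; ring.
have A0 : 0 <= A by apply: dsum_ge0 => l k _ _; exact: sqr_ge0.
have Q0 : 0 <= Q by apply: dsum_ge0 => l k _ _; exact: sqr_ge0.
have [Q00|Qn0] := eqVneq Q 0; last first.
  have Qgt : 0 < Q by rewrite lt_neqAle eq_sym Qn0.
  have := quad (P / Q); have -> : A + (- 2 * (P / Q) * P + (P / Q) ^+ 2 * Q) =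
    (A * Q - P ^+ 2) / Q by field.
  by rewrite pmulr_lge0 ?invr_gt0 // subr_ge0.
rewrite Q00 mulr0; have [->|P0] := eqVneq P 0; first by rewrite expr0n.
have := quad ((A + 1) / (2 * P)); rewrite Q00 mulr0 addr0.
have -> : A + - 2 * ((A + 1) / (2 * P)) * P = - 1 by field.
by rewrite oppr_ge0 ler10.
Qed.

End DoubleSum.

Section Harmonics.
Context {R : realType} {d : nat} (mu : probability (borel_space R d) R).
Hypotheses (hd : (0 < d)%N) (hmu : rotation_invariant mu).
Context (Z : nat -> nat) (Y : nat -> nat -> 'rV[R]_d.+1 -> R).
Hypothesis hY : harmonic_basis mu Z Y.
Local Notation rV := ('rV[R]_d.+1).
Local Notation S := (@sphere R d).
Local Notation dsum := (dsum Z).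
Local Notation ip := (ip mu).
Local Notation homog k p := (p \is ishomog1 k mdeg).
Local Notation ev p := (fun x : rV => meval (fun i => x 0 i) p).
Implicit Types (u v : rV -> R) (c : nat -> nat -> R) (x : rV).

Lemma meval_scont (p : mpoly d.+1 R) : scont (ev p).
Proof.
have coordc i : scont (fun x : rV => x 0 i).
  by apply: continuous_scont => x; exact: coord_continuous.
have prodc (m : multinom d.+1) (r : seq 'I_d.+1) :
    scont (fun x : rV => \prod_(i <- r) x 0 i ^+ m i).
  elim: r => [|i r IH].
    by apply: eq_scont (scont_cst 1) => x _; rewrite big_nil.
  have pc : scont (fun x : rV => x 0 i ^+ m i).
    elim: (m i) => [|n IHn]; first exact: scont_cst.
    by apply: eq_scont (scontM (coordc i) IHn) => x _; rewrite exprS.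
  by apply: eq_scont (scontM pc IH) => x _; rewrite big_cons.
have c : scont (fun x : rV => \sum_(m <- msupp p) mcoeff m p * \prod_i x 0 i ^+ m i).
  by apply: scont_sum => m _; apply: scontZ; exact: prodc.
by apply: eq_scont c => x _; rewrite mevalE.
Qed.

Lemma Y_poly l k : (k < Z l)%N -> exists p : mpoly d.+1 R,
  [/\ homog l p, laplacian p = 0 & forall x, S x -> Y l k x = ev p x].
Proof. by case: hY => h _ _ _ /h. Qed.

Lemma Y_scont l k : (k < Z l)%N -> scont (Y l k).
Proof.
move=> /Y_poly[p [_ _ Yp]]; apply: eq_scont (meval_scont p) => x Sx.
by rewrite Yp.
Qed.

Lemma Y_sqint l k : (k < Z l)%N -> sqint mu (Y l k).
Proof. by move=> kl; apply: sqint_scont; exact: Y_scont. Qed.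

(** The polynomial of degree less than [n] with Fourier coefficients [c]. *)
Definition comb n c x : R := dsum n (fun l k => c l k * Y l k x).
Definition coef u l k : R := ip u (Y l k).

Lemma comb_scont n c : scont (comb n c).
Proof.
apply: scont_sum => l _; apply: scont_sum => k _; apply: scontZ.
exact: Y_scont.
Qed.

Lemma comb_sqint n c : sqint mu (comb n c).
Proof. by apply: sqint_scont; exact: comb_scont. Qed.

Lemma ip_comb n c u : sqint mu u ->
  ip u (comb n c) = dsum n (fun l k => c l k * coef u l k).
Proof.
move=> hu; rewrite ip_sumr //; last first.
  by move=> l _; apply: sqint_sum => k _; apply: sqintZ; exact: Y_sqint.
apply: eq_bigr => l _; rewrite ip_sumr //; last first.
  by move=> k _; apply: sqintZ; exact: Y_sqint.
by apply: eq_bigr => k _; rewrite ipZr //; exact: Y_sqint.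
Qed.

Lemma coef_comb n c l k : (k < Z l)%N ->
  coef (comb n c) l k = if (l < n)%N then c l k else 0.
Proof.
move=> kl; rewrite /coef ipC ip_comb; last exact: Y_sqint.
have orth l' k' : (k' < Z l')%N ->
    coef (Y l k) l' k' = ((l == l') && (k == k'))%:R.
  by move=> k'l'; case: hY => _ _ h _; exact: h.
case: ltnP => ln.
  rewrite /dsum (bigD1 (Ordinal ln)) //= (bigD1 (Ordinal kl)) //=.
  rewrite orth // !eqxx mulr1 big1 ?addr0 => [|k' k'k]; last first.
    rewrite orth // eqxx /= (_ : (k == k') = false) ?mulr0 //.
    by apply/negbTE; rewrite eq_sym.
  rewrite big1 ?addr0 // => l' l'l; rewrite big1 // => k' _.
  by rewrite orth // (_ : (l == l') = false) ?mulr0 //; apply/negbTE; rewrite eq_sym.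
rewrite /dsum big1 // => l' _; rewrite big1 // => k' _.
by rewrite orth // gtn_eqF ?mulr0 // (leq_trans (ltn_ord l')).
Qed.

Lemma ip_comb2 n c : ip (comb n c) (comb n c) = dsum n (fun l k => c l k ^+ 2).
Proof.
rewrite ip_comb; last exact: comb_sqint.
by apply: eq_dsum => l k ln kl; rewrite coef_comb // ln expr2.
Qed.

Definition hspan n u : Prop := exists c, forall x, S x -> u x = comb n c x.

Lemma eq_hspan n u v : (forall x, S x -> u x = v x) -> hspan n u -> hspan n v.
Proof. by move=> uv [c uc]; exists c => x Sx; rewrite -uv // uc. Qed.

Lemma hspan_le n m u : (n <= m)%N -> hspan n u -> hspan m u.
Proof.
move=> nm [c uc]; exists (fun l k => if (l < n)%N then c l k else 0) => x Sx.
rewrite uc // /comb (dsum_widen _ _ nm); apply: eq_dsum => l k _ _.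
by case: ifP => _ //; rewrite mul0r.
Qed.

Lemma hspan0 n : hspan n (fun=> 0).
Proof.
exists (fun _ _ => 0) => x _; rewrite /comb /dsum big1 // => l _.
by rewrite big1 // => k _; rewrite mul0r.
Qed.

Lemma hspanD n u v : hspan n u -> hspan n v -> hspan n (fun x => u x + v x).
Proof.
move=> [c uc] [c' vc']; exists (fun l k => c l k + c' l k) => x Sx.
by rewrite uc // vc' // -dsumD; apply: eq_dsum => l k _ _; rewrite mulrDl.
Qed.

Lemma hspanZ n a u : hspan n u -> hspan n (fun x => a * u x).
Proof.
move=> [c uc]; exists (fun l k => a * c l k) => x Sx.
by rewrite uc // -dsumZ; apply: eq_dsum => l k _ _; rewrite mulrA.
Qed.

Lemma hspan_sum n (I : eqType) (r : seq I) (F : I -> rV -> R) :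
  (forall i, i \in r -> hspan n (F i)) -> hspan n (fun x => \sum_(i <- r) F i x).
Proof.
elim: r => [_|i r IH Fi].
  by apply: eq_hspan (hspan0 n) => x _; rewrite big_nil.
have Fr : hspan n (fun x => \sum_(i <- r) F i x).
  by apply: IH => j jr; apply: Fi; rewrite inE jr orbT.
by apply: eq_hspan (hspanD (Fi i (mem_head _ _)) Fr) => x _; rewrite big_cons.
Qed.

Lemma hspan_dsum n m (F : nat -> nat -> rV -> R) :
  (forall l k, (l < m)%N -> (k < Z l)%N -> hspan n (F l k)) ->
  hspan n (fun x => dsum m (fun l k => F l k x)).
Proof.
by move=> hF; apply: hspan_sum => l _; apply: hspan_sum => k _; exact: hF.
Qed.

Lemma spherical_harmonic_hspan l u : spherical_harmonic l u -> hspan l.+1 u.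
Proof.
case: hY => _ h _ _ /h[c uc].
exists (fun l' k => if l' == l then c k else 0) => x Sx.
rewrite uc // /comb dsumS /dsum [X in _ = X + _]big1 => [|l' _].
  by rewrite add0r; apply: eq_bigr => k _; rewrite eqxx.
by rewrite big1 // => k _; rewrite (ltn_eqF (ltn_ord l')) mul0r.
Qed.

Lemma meval_radius2 x : S x -> meval (fun i => x 0 i) radius2 = 1.
Proof.
move=> /sphereE <-; rewrite raddf_sum; apply: eq_bigr => i _ /=.
by rewrite rmorphXn /= mevalXU expr2.
Qed.

(** On the sphere the factors [|x|^(2 j)] of the Fischer decomposition are
    equal to one. *)
Lemma homog_hspan l (p : mpoly d.+1 R) : homog l p -> hspan l.+1 (ev p).
Proof.
move=> hp; have [h [pE hh]] := fischer_decomposition (ltn0Sn d) hp.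
have hs : hspan l.+1 (fun x => \sum_(j < (l./2).+1) ev (h j) x).
  apply: hspan_sum => j _; have [hj hj0] := hh j (ltn_ord j).
  apply: (@hspan_le (l - 2 * j).+1); first by rewrite ltnS leq_subr.
  by apply: spherical_harmonic_hspan; exists (h j); split.
apply: eq_hspan hs => x Sx; rewrite pE raddf_sum; apply: eq_bigr => j _ /=.
by rewrite mevalM rmorphXn /= meval_radius2 // expr1n mul1r.
Qed.

(** A product of harmonics is a homogeneous polynomial, whose degree is the
    sum of their degrees. *)
Lemma hspanM a b u v : hspan a u -> hspan b v -> hspan (a + b) (fun x => u x * v x).
Proof.
move=> [c uc] [c' vc'].
have hs : hspan (a + b) (fun x => dsum a (fun l k =>
    dsum b (fun l' k' => c l k * c' l' k' * (Y l k x * Y l' k' x)))).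
  apply: hspan_dsum => l k la kl; apply: hspan_dsum => l' k' lb kl'; apply: hspanZ.
  have [p [hp _ Yp]] := Y_poly kl; have [p' [hp' _ Yp']] := Y_poly kl'.
  apply: (@hspan_le (l + l').+1); first by rewrite -addnS leq_add // ltnW.
  apply: eq_hspan (homog_hspan (dhomogM hp hp')) => x Sx.
  by rewrite mevalM Yp // Yp'.
apply: eq_hspan hs => x Sx; rewrite uc // vc' // mulrC /comb -dsumZ.
apply: eq_dsum => l k _ _; rewrite mulrC -dsumZ; apply: eq_dsum => l' k' _ _.
by ring.
Qed.

Lemma hspan_rotation (U : 'M[R]_d.+1) n u : is_rotation U -> hspan n u ->
  hspan n (fun x => u (x *m U)).
Proof.
move=> hU [c uc].
have hs : hspan n (fun x => comb n c (x *m U)).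
  apply: hspan_dsum => l k ln kl; apply: hspanZ.
  have [p [hp _ Yp]] := Y_poly kl.
  apply: hspan_le ln _; apply: eq_hspan (homog_hspan (homog_lin_subst U hp)) => x Sx.
  by rewrite meval_lin_subst Yp //; exact: rotation_sphere.
by apply: eq_hspan hs => x Sx; rewrite uc //; exact: rotation_sphere.
Qed.

(** [spectral_density n] is the diagonal of the reproducing kernel of the
    polynomials of degree less than [n]. *)
Definition spectral_density n x : R := dsum n (fun l k => Y l k x ^+ 2).

(** The density at [x] is the largest value at [x] of the square of a
    polynomial of unit norm and of degree less than [n].  A rotation from [y]
    to [x] carries a maximizer at [x], the reproducing kernel, to a competitor
    at [y]. *)
Lemma spectral_density_le n x y : S x -> S y ->
  spectral_density n x <= spectral_density n y.
Proof.
move=> Sx Sy; have [U hU yUx] := rotation_transitive hd Sy Sx.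
pose v := comb n (fun l k => Y l k x).
have [b wb] : hspan n (fun z => v (z *m U)).
  by apply: hspan_rotation => //; exists (fun l k => Y l k x).
have vx : v x = spectral_density n x.
  by apply: eq_dsum => l k _ _; rewrite expr2.
have wy : comb n b y = spectral_density n x by rewrite -wb // yUx.
have b2 : dsum n (fun l k => b l k ^+ 2) = spectral_density n x.
  rewrite -ip_comb2 -[RHS]ip_comb2 -/v.
  rewrite -[RHS](sint_rotation hmu hU (scontM (comb_scont n _) (comb_scont n _))).
  by apply: eq_sint => z Sz; rewrite -wb.
have := dsum_cauchy_schwarz Z n b (fun l k => Y l k y).
rewrite -/(comb n b y) wy b2 -/(spectral_density n y).
have : 0 <= spectral_density n x by apply: dsum_ge0 => l k _ _; exact: sqr_ge0.
rewrite le_eqVlt => /predU1P[<- _|x0]; first by apply: dsum_ge0 => *; exact: sqr_ge0.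
by rewrite expr2 ler_pM2l.
Qed.

(** The partial densities up to degree [l] and up to degree [l + 1] are both
    constant, hence so is their difference, whose integral is [Z l]. *)
Lemma addition_theorem l x : S x -> \sum_(k < Z l) Y l k x ^+ 2 = (Z l)%:R.
Proof.
move=> Sx; have cst y : S y ->
    \sum_(k < Z l) Y l k y ^+ 2 = \sum_(k < Z l) Y l k x ^+ 2.
  move=> Sy; have e n : spectral_density n y = spectral_density n x.
    by apply/eqP; rewrite eq_le !spectral_density_le.
  have := e l.+1; rewrite /spectral_density !dsumS; move: (e l).
  by rewrite /spectral_density => -> /addrI.
rewrite -(sint_cst hmu (\sum_(k < Z l) Y l k x ^+ 2)).
transitivity (sint mu (fun y => 1 * \sum_(k < Z l) Y l k y ^+ 2)).
  by apply: eq_sint => y Sy; rewrite mul1r cst.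
have Y2 (k : 'I_(Z l)) : sqint mu (fun y => Y l k y ^+ 2).
  apply: sqint_scont; apply: scontM; exact: Y_scont.
rewrite -/(ip _ _) ip_sumr //; last exact: sqint_cst.
rewrite -[Z l in RHS]card_ord -sumr_const; apply: eq_bigr => k _.
transitivity (ip (Y l k) (Y l k)).
  by apply: eq_sint => y _; rewrite mul1r expr2.
by case: hY => _ _ h _; rewrite (h _ _ _ _ _ _ : ip _ _ = _) // !eqxx.
Qed.

Lemma Z_le l : (Z l <= 2 * l.+1 ^ d.-1)%N.
Proof.
have /choice[P hP] : forall k, exists p : mpoly d.+1 R, (k < Z l)%N ->
   [/\ homog l p, laplacian p = 0 & forall x, S x -> Y l k x = ev p x].
  move=> k; have [/Y_poly[p hp]|kl] := ltnP k (Z l); first by exists p.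
  by exists 0.
apply: (leq_harmonic_dimension (P := P) hd) => [k /hP[] //|v v0 k].
(* The coefficients [v] in degree [l], and zero in the other degrees. *)
pose c l' k' := if (l' == l) then oapp v 0 (insub k' : option 'I_(Z l)) else 0.
have cv (j : 'I_(Z l)) : c l j = v j.
  by rewrite /c eqxx insubT //= => ?; congr v; exact: val_inj.
have c0 x : S x -> comb l.+1 c x = 0.
  move=> Sx; rewrite /comb dsumS /dsum big1 ?add0r => [|l' _].
    transitivity (ev (\sum_k v k *: P k) x); last by rewrite v0 meval0.
    rewrite raddf_sum; apply: eq_bigr => j _ /=; rewrite cv mevalZ.
    by have [_ _ ->] := hP j (ltn_ord j).
  by rewrite big1 // => j _; rewrite /c (ltn_eqF (ltn_ord l')) mul0r.
have := @coef_comb l.+1 c l k (ltn_ord k); rewrite ltnSn cv => <-.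
by rewrite /coef ipC -[RHS](ip0r mu (Y l k)); exact: eq_ip.
Qed.

End Harmonics.

(** * Summation by parts and weights *)

Section RealSums.
Context {R : realType}.

(** Comparison of the series of [b ^ (- 1 - p)] with a telescoping one: the
    right-hand side is [b ^ (- p) * ((1 - 1 / b) ^ (- p) - 1)], and
    [- ln (1 - 1 / b) >= 1 / b]. *)
Lemma powR_telescope (p b : R) : 0 < p -> 1 < b ->
  p * b `^ (- (1 + p)) <= (b - 1) `^ (- p) - b `^ (- p).
Proof.
move=> p0 b1; have b0 : 0 < b by rewrite (lt_trans _ b1).
have t1 : 0 < 1 - b^-1 by rewrite subr_gt0 invf_lt1.
have -> : b - 1 = b * (1 - b^-1) by rewrite mulrBr mulr1 mulfV // gt_eqF.
rewrite powRM ?(ltW b0) ?(ltW t1) // -{2}[b `^ (- p)]mulr1 -mulrBr.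
rewrite opprD powRD ?(gt_eqF b0) ?implybT // powR_inv1 ?(ltW b0) // mulrA mulrC.
rewrite ler_wpM2l ?powR_ge0 // lerBrDr addrC /powR (gt_eqF t1).
apply: le_trans (expR_ge1Dx _); rewrite lerD2l mulNr -mulrN ler_wpM2l ?(ltW p0) //.
by rewrite lerNr; apply: le_ln1Dx; rewrite ltrN2 invf_lt1.
Qed.

Lemma powR_series_bounded (p : R) n : 0 < p ->
  \sum_(l < n) (1 + l%:R) `^ (- (1 + p)) <= 1 + p^-1 :> R.
Proof.
move=> p0; case: n => [|n].
  by rewrite big_ord0 addr_ge0 // invr_ge0 ltW.
suff : \sum_(l < n.+1) (1 + l%:R) `^ (- (1 + p)) <=
    1 + p^-1 * (1 - (1 + n%:R) `^ (- p)) :> R.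
  move/le_trans; apply; rewrite lerD2l -[leRHS]mulr1 ler_wpM2l ?invr_ge0 ?(ltW p0) //.
elim: n => [|n IH].
  by rewrite big_ord1 addr0 !powR1 subrr mulr0 addr0.
rewrite big_ord_recr /=; apply: le_trans (lerD IH (lexx _)) _.
set A := (1 + n%:R) `^ (- p); set C := (1 + n.+1%:R) `^ (- p).
rewrite -addrA lerD2l -lerBrDl -mulrBr (_ : 1 - C - (1 - A) = A - C); last by ring.
rewrite -(ler_pM2l p0) [leRHS]mulrA mulfV ?gt_eqF // mul1r.
have := @powR_telescope p (1 + n.+1%:R) p0.
rewrite ltrDl ltr0n => /(_ isT) /le_trans; apply.
rewrite (_ : 1 + n.+1%:R - 1 = 1 + n%:R); last by rewrite addrC addKr -natr1 addrC.
by [].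
Qed.

Lemma sum_linear (w f g : nat -> R) (a b : R) L :
  \sum_(n < L) w n * (a * f n + b * g n) =
  a * (\sum_(n < L) w n * f n) + b * (\sum_(n < L) w n * g n).
Proof. by rewrite !mulr_sumr -big_split; apply: eq_bigr => n _ /=; ring. Qed.

(** The exchange of sums behind the summations by parts: [delta] are the
    increments of a weight, and [f] is the identity or the halving of indices. *)
Lemma abel_exchange (delta a : nat -> R) (f : nat -> nat) L M :
  \sum_(n < L) delta n * (\sum_(l < M) if (n <= f l)%N then a l else 0) =
  \sum_(l < M) a l * (\sum_(n < L) if (n <= f l)%N then delta n else 0).
Proof.
under eq_bigr do rewrite mulr_sumr.
rewrite exchange_big; apply: eq_bigr => l _; rewrite mulr_sumr.
by apply: eq_bigr => n _; case: ifP; rewrite ?mulr0 // mulrC.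
Qed.

Definition increment (w : nat -> R) n : R := if n is m.+1 then w n - w m else w 0%N.

Lemma increment_ge0 w n : (forall n, w n <= w n.+1) -> 0 <= w 0%N ->
  0 <= increment w n.
Proof. by case: n => //= n wS _; rewrite subr_ge0. Qed.

Lemma sum_increment w n : \sum_(k < n.+1) increment w k = w n.
Proof.
elim: n => [|n IH]; first by rewrite big_ord1.
by rewrite big_ord_recr /= IH addrC subrK.
Qed.

Lemma sum_increment_if w n L : (n < L)%N ->
  \sum_(k < L) (if (k <= n)%N then increment w k else 0) = w n.
Proof.
move=> nL; rewrite -sum_increment (big_ord_widen L _ nL) [RHS]big_mkcond.
by apply: eq_bigr => k _; rewrite ltnS.
Qed.

Lemma sum_increment_le w n L : (forall n, w n <= w n.+1) -> 0 <= w 0%N ->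
  \sum_(k < L) (if (k <= n)%N then increment w k else 0) <= w n.
Proof.
move=> wS w0; rewrite -(@sum_increment_if w n (maxn L n.+1)) ?leq_maxr //.
rewrite (big_ord_widen (maxn L n.+1)
  (fun k => if (k <= n)%N then increment w k else 0) (leq_maxl _ _)) [leLHS]big_mkcond /=.
apply: ler_sum => k _; case: ifP => // _; case: ifP => // _.
exact: increment_ge0.
Qed.

End RealSums.

Lemma half_le l : (l./2 <= l)%N.
Proof. by have := odd_double_half l; lia. Qed.

Section Weights.
Context {R : realType}.

Definition weight (s : R) (l : nat) : R := (1 + l%:R) `^ (2 * s).

Lemma weight_gt0 s l : 0 < weight s l.
Proof. by rewrite powR_gt0 // ltr_wpDr. Qed.

Lemma weight_half s l : 0 <= s -> weight s l <= 2 `^ (2 * s) * weight s l./2.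
Proof.
move=> s0; rewrite -powRM // ?addr_ge0 //.
apply: ge0_ler_powR; rewrite ?nnegrE ?mulr_ge0 ?addr_ge0 //.
rewrite !nat1r -natrM ler_nat; have := odd_double_half l; lia.
Qed.

Lemma weight_leS s l : 0 <= s -> weight s l <= weight s l.+1.
Proof.
move=> s0; apply: ge0_ler_powR; rewrite ?nnegrE ?mulr_ge0 ?addr_ge0 //.
by rewrite lerD2l ler_nat.
Qed.

End Weights.

(** * Fourier series and Sobolev norms *)

Section FourierAnalysis.
Context {R : realType} {d : nat} (mu : probability (borel_space R d) R).
Hypotheses (hd : (0 < d)%N) (hmu : rotation_invariant mu).
Context (Z : nat -> nat) (Y : nat -> nat -> 'rV[R]_d.+1 -> R).
Hypothesis hY : harmonic_basis mu Z Y.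
Local Notation rV := ('rV[R]_d.+1).
Local Notation S := (@sphere R d).
Local Notation mS := (@sphere R d : set (borel_space R d)).
Local Notation dsum := (dsum Z).
Local Notation ip := (ip mu).
Local Notation comb := (comb Z Y).
Local Notation coef := (coef mu Y).
Local Notation hspan := (hspan Z Y).
Local Notation sqint := (sqint mu).
Implicit Types (u v : rV -> R) (c : nat -> nat -> R) (x : rV).

(** Cauchy-Schwarz with the weights [(1 + l) ^ sigma]: by the addition theorem
    the constant is the sum of [(1 + l) ^ (- 2 sigma) * Z l], which converges
    as [2 sigma - (d - 1) > 1]. *)
Lemma comb_sup_bound (sigma : R) : d%:R / 2 < sigma ->
  exists2 K : R, 0 < K & forall n c x, S x ->
    comb n c x ^+ 2 <= K * dsum n (fun l k => weight sigma l * c l k ^+ 2).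
Proof.
move=> hsigma; pose p := 2 * sigma - d%:R.
have p0 : 0 < p by rewrite subr_gt0 mulrC -ltr_pdivrMr.
exists (2 * (1 + p^-1)); first by rewrite mulr_gt0 // addr_gt0 // invr_gt0.
move=> n c x Sx.
pose w (l : nat) : R := (1 + l%:R) `^ sigma.
have w0 l : 0 < w l by rewrite powR_gt0 // ltr_wpDr.
have w2 l : w l ^+ 2 = weight sigma l by rewrite /weight mulrC powRrM powR_mulrn // ltW.
have -> : comb n c x = dsum n (fun l k => (w l * c l k) * ((w l)^-1 * Y l k x)).
  by apply: eq_dsum => l k _ _; rewrite mulrACA mulfV ?mul1r // gt_eqF.
apply: le_trans (dsum_cauchy_schwarz _ _ _ _) _.
rewrite (eq_dsum (G := fun l k => weight sigma l * c l k ^+ 2)); last first.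
  by move=> l k _ _; rewrite exprMn w2.
rewrite mulrC; apply: ler_wpM2r.
  by apply: dsum_ge0 => l k _ _; rewrite mulr_ge0 ?sqr_ge0 // ltW // weight_gt0.
apply: le_trans (_ : 2 * \sum_(l < n) (1 + l%:R) `^ (- (1 + p)) <= _); last first.
  by rewrite ler_pM2l // powR_series_bounded.
rewrite mulr_sumr; apply: ler_sum => l _.
under eq_bigr do rewrite exprMn exprVn w2.
rewrite -mulr_sumr (addition_theorem hd hmu hY) //.
have -> : - (1 + p) = - (2 * sigma) + (d.-1)%:R.
  by rewrite /p -subn1 natrB //; ring.
rewrite powRD; last by apply/implyP => _; rewrite gt_eqF // ltr_wpDr.
rewrite powRN powR_mulrn ?addr_ge0 // mulrCA ler_wpM2l ?invr_ge0 ?powR_ge0 //.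
by have := Z_le hd hY l; rewrite -(ler_nat R) natrM natrX nat1r.
Qed.

Lemma fourier_coefB u v l k : sqint u -> sqint v -> (k < Z l)%N ->
  coef (fun x => u x - v x) l k = coef u l k - coef v l k.
Proof. by move=> hu hv kl; apply: ipBl => //; exact: (Y_sqint hY). Qed.

Definition fourier_sum n u : rV -> R := comb n (coef u).

Lemma fourier_sum_scont n u : scont (fourier_sum n u).
Proof. exact: (comb_scont hY). Qed.

Lemma fourier_sum_sqint n u : sqint (fourier_sum n u).
Proof. exact: (comb_sqint hY). Qed.

Lemma fourier_sum_hspan n u : hspan n (fourier_sum n u).
Proof. by exists (coef u). Qed.

Lemma pythagoras n u : sqint u ->
  ip (fun x => u x - fourier_sum n u x) (fun x => u x - fourier_sum n u x) =
  ip u u - dsum n (fun l k => coef u l k ^+ 2).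
Proof.
move=> hu; rewrite ip_sub2 //; last exact: fourier_sum_sqint.
rewrite (ip_comb2 hY) (ip_comb hY) //.
under eq_dsum do rewrite -expr2.
by ring.
Qed.

Lemma bessel n u : sqint u -> dsum n (fun l k => coef u l k ^+ 2) <= ip u u.
Proof. by move=> hu; rewrite -subr_ge0 -pythagoras // ip_ge0. Qed.

(** Subtracting a polynomial of smaller degree does not change the tail of the
    Fourier coefficients, to which the Bessel inequality applies. *)
Lemma tail_le n m u v : sqint u -> hspan m v ->
  dsum n (fun l k => if (m <= l)%N then coef u l k ^+ 2 else 0) <=
  ip (fun x => u x - v x) (fun x => u x - v x).
Proof.
move=> hu [c vc].
rewrite (eq_ip _ (u' := fun x => u x - comb m c x) (v' := fun x => u x - comb m c x)); first last.
- by move=> x Sx; rewrite vc.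
- by move=> x Sx; rewrite vc.
have hc := comb_sqint hY m c.
apply: le_trans (bessel n (sqintB hu hc)); apply: ler_dsum => l k _ kl.
rewrite fourier_coefB // (coef_comb hY) //; case: leqP => ml; last exact: sqr_ge0.
by rewrite subr0.
Qed.

Lemma sint_fine u : sint mu u = fine (\int[mu]_(x in mS) (u x)%:E)%E.
Proof. by []. Qed.

Lemma coef_csint u l k : fcoef mu Y (fun x => (u x)%:C%C) l k = (coef u l k)%:C%C.
Proof.
apply/eqP; rewrite eq_complex /=; apply/andP; split; apply/eqP.
  by apply: eq_sint => x _ /=; rewrite mul0r subr0.
rewrite -[RHS](ip0r mu u); apply: eq_sint => x _ /=.
by rewrite !mulr0 mul0r addr0.
Qed.

Lemma normc_real (a : R) : Normc.normc (a%:C%C) ^+ 2 = a ^+ 2.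
Proof. by rewrite /= expr0n addr0 sqr_sqrtr // sqr_ge0. Qed.

(** The completeness of the basis, which is stated for complex-valued
    functions, restricted to the real ones. *)
Lemma parseval u : sqint u ->
  (fun n => ip (fun x => u x - fourier_sum n u x) (fun x => u x - fourier_sum n u x))
    @ \oo --> 0.
Proof.
move=> hu; have hL2 : in_L2 mu (fun x => (u x)%:C%C).
  case: (hu) => mu_ iu; split; [exact: mu_|exact: (@measurable_cst _ _ _ R)|].
  move: iu => /integrableP[_]; congr (_ < _)%E; apply: eq_integral => x _.
  by rewrite normc_real gee0_abs // lee_fin sqr_ge0.
case: hY => _ _ _ /(_ _ hL2) /fine_cvg /=.
apply: cvg_trans; apply: near_eq_cvg; apply: nearW => n /=.
rewrite /ip sint_fine /L2sq; congr fine; apply: eq_integral => x /set_mem Sx.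
congr EFin.
transitivity (Normc.normc ((u x - fourier_sum n u x)%:C%C) ^+ 2).
  congr (Normc.normc _ ^+ 2); rewrite rmorphB /=; congr (_ - _).
  rewrite rmorph_sum; apply: eq_bigr => l _ /=.
  rewrite rmorph_sum; apply: eq_bigr => k _ /=.
  by rewrite coef_csint rmorphM.
by rewrite normc_real expr2.
Qed.

Definition energy u l : R := \sum_(k < Z l) coef u l k ^+ 2.
Definition residual n u : R :=
  ip (fun x => u x - fourier_sum n u x) (fun x => u x - fourier_sum n u x).
(** Sobolev norms are handled through the partial sums of their squares, which
    are real numbers, and finiteness as a bound uniform in [n]. *)
Definition sob s n u : R := dsum n (fun l k => weight s l * coef u l k ^+ 2).

Lemma energy_ge0 u l : 0 <= energy u l.
Proof. by apply: sumr_ge0 => k _; exact: sqr_ge0. Qed.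

Lemma sobE s n u : sob s n u = \sum_(l < n) weight s l * energy u l.
Proof. by apply: eq_bigr => l _; rewrite mulr_sumr. Qed.

Lemma dsum_tail n m u :
  dsum n (fun l k => if (m <= l)%N then coef u l k ^+ 2 else 0) =
  \sum_(l < n) if (m <= l)%N then energy u l else 0.
Proof.
apply: eq_bigr => l _; case: ifP => ml; first by [].
by rewrite big1.
Qed.

Lemma residual_split n M u : sqint u -> (n <= M)%N ->
  residual n u = (\sum_(l < M) if (n <= l)%N then energy u l else 0) + residual M u.
Proof.
move=> hu nM; rewrite /residual !pythagoras // -dsum_tail.
rewrite (dsum_widen _ _ nM).
have -> : dsum M (fun l k => coef u l k ^+ 2) =
    dsum M (fun l k => if (n <= l)%N then coef u l k ^+ 2 else 0) +
    dsum M (fun l k => if (l < n)%N then coef u l k ^+ 2 else 0).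
  rewrite -dsumD; apply: eq_dsum => l k _ _.
  by case: ltnP; rewrite ?add0r ?addr0.
by ring.
Qed.

(** Summation by parts of the squared Sobolev norm.  The residual at [n] is an
    infinite tail: it is cut at degree [M], and the remainder tends to zero
    as [M] grows. *)
Lemma weighted_residuals s L u B : 0 <= s -> sqint u -> (forall n, sob s n u <= B) ->
  \sum_(n < L) increment (weight s) n * residual n u <= B.
Proof.
move=> s0 hu hB; set D := \sum_(n < L) increment (weight s) n.
have w00 : 0 <= weight s 0 by exact/ltW/weight_gt0.
have lim : (fun M => B + D * residual M u) @ \oo --> B + D * 0.
  by apply: cvgD; [exact: cvg_cst|apply: cvgMr; exact: parseval].
suff : \sum_(n < L) increment (weight s) n * residual n u <= B + D * 0.
  by rewrite mulr0 addr0.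
apply: cvgr_to_ge lim _; exists L => // M /= LM.
have -> : \sum_(n < L) increment (weight s) n * residual n u =
  \sum_(n < L) increment (weight s) n *
     (\sum_(l < M) if (n <= l)%N then energy u l else 0) + D * residual M u.
  rewrite /D mulr_suml -big_split; apply: eq_bigr => n _ /=.
  rewrite -mulrDr; congr (_ * _); apply: residual_split => //.
  by rewrite (leq_trans (ltnW (ltn_ord n))).
rewrite lerD2r (abel_exchange _ _ id); apply: le_trans (hB M).
rewrite sobE; apply: ler_sum => l _; rewrite mulrC ler_wpM2r ?energy_ge0 //.
by apply: sum_increment_le => // n; exact: weight_leS.
Qed.

Section SupBound.
Variables (sigma K : R).
Hypotheses (sigma0 : 0 <= sigma) (K0 : 0 <= K).
Hypothesis hK : forall n c x, S x ->
  comb n c x ^+ 2 <= K * dsum n (fun l k => weight sigma l * c l k ^+ 2).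

Lemma fourier_sum_sup n u B x : S x -> sob sigma n u <= B ->
  fourier_sum n u x ^+ 2 <= K * B.
Proof.
by move=> Sx uB; apply: le_trans (hK _ _ Sx) _; rewrite ler_wpM2l.
Qed.

(** Comparing [u * h] to the product of the Fourier sums of [u] and [h], which
    has degree less than [2 n], bounds its tail from degree [2 n] on by the
    residuals of [u] and [h] at [n].  Summing by parts with the weight at
    [l / 2] then gives the Sobolev norms of [u] and [h]; moving the weight from
    [l / 2] to [l] costs the factor [2 ^ (2 sigma)].  The constant does not
    depend on the degree of the polynomial [h]. *)
Lemma sobolev_algebra u m b B H L : sqint u ->
  (forall n, sob sigma n u <= B) -> (forall n, sob sigma n (comb m b) <= H) ->
  sob sigma L (fun x => u x * comb m b x) <=
    2 `^ (2 * sigma) * (4 * K * B * H).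
Proof.
move=> hu uB hH; set h := comb m b.
have hc : scont h by exact: (comb_scont hY).
have hsq : sqint h by exact: sqint_scont.
have h2 x : S x -> h x ^+ 2 <= K * H.
  move=> Sx; apply: le_trans (hK _ _ Sx) _; apply: ler_wpM2l => //.
  apply: le_trans (hH m); apply: ler_dsum => l k lm kl.
  by rewrite (coef_comb hY) // lm.
have huh : sqint (fun x => u x * h x).
  by apply: eq_sqint (sqint_scontM hc hu) => x _; rewrite mulrC.
have B0 : 0 <= B by apply: le_trans (uB 0%N); rewrite /sob /dsum big_ord0.
have H0 : 0 <= H by apply: le_trans (hH 0%N); rewrite /sob /dsum big_ord0.
have tail n : (\sum_(l < L) if (n <= l./2)%N then energy (fun x => u x * h x) l else 0)
    <= 2 * (K * H) * residual n u + 2 * (K * B) * residual n h.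
  pose v x := fourier_sum n u x * fourier_sum n h x.
  have vs : hspan (n + n) v.
    by apply: (hspanM hY); exact: fourier_sum_hspan.
  apply: le_trans (_ : ip (fun x => u x * h x - v x) (fun x => u x * h x - v x) <= _).
    apply: le_trans (tail_le L huh vs); rewrite dsum_tail.
    by apply: ler_sum => l _; rewrite addnn geq_half_double.
  (* [u * h - S_n u * S_n h] is the sum of the following two functions. *)
  pose p x := (u x - fourier_sum n u x) * h x.
  pose q x := fourier_sum n u x * (h x - fourier_sum n h x).
  have hsu : sqint (fun x => u x - fourier_sum n u x).
    by apply: sqintB => //; exact: fourier_sum_sqint.
  have hsh : sqint (fun x => h x - fourier_sum n h x).
    by apply: sqintB => //; exact: fourier_sum_sqint.
  have hp : sqint p.
    by apply: eq_sqint (sqint_scontM hc hsu) => x _; rewrite mulrC.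
  have hq : sqint q by apply: sqint_scontM => //; exact: fourier_sum_scont.
  rewrite (eq_ip _ (u' := fun x => p x + q x) (v' := fun x => p x + q x)); first last.
  - by move=> x _; rewrite /p /q /v; ring.
  - by move=> x _; rewrite /p /q /v; ring.
  apply: le_trans (ip_addle hp hq) _; rewrite -!mulrA.
  apply: lerD; apply: ler_wpM2l => //; rewrite mulrA; apply: le_ip => // x Sx.
    by rewrite exprMn mulrC ler_wpM2r ?sqr_ge0 // h2.
  by rewrite exprMn ler_wpM2r ?sqr_ge0 // (fourier_sum_sup Sx (uB n)).
rewrite sobE.
apply: le_trans (_ : 2 `^ (2 * sigma) *
    \sum_(l < L) weight sigma l./2 * energy (fun x => u x * h x) l <= _).
  rewrite mulr_sumr; apply: ler_sum => l _.
  by rewrite mulrA ler_wpM2r ?energy_ge0 // weight_half.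
rewrite ler_wpM2l ?powR_ge0 //.
have -> : \sum_(l < L) weight sigma l./2 * energy (fun x => u x * h x) l =
  \sum_(n < L) increment (weight sigma) n *
   (\sum_(l < L) if (n <= l./2)%N then energy (fun x => u x * h x) l else 0).
  rewrite (abel_exchange _ _ half); apply: eq_bigr => l _; rewrite mulrC.
  congr (_ * _); rewrite sum_increment_if //.
  by apply: leq_ltn_trans (ltn_ord l); exact: half_le.
apply: le_trans (_ : \sum_(n < L) increment (weight sigma) n *
   (2 * (K * H) * residual n u + 2 * (K * B) * residual n h) <= _).
  apply: ler_sum => n _; apply: ler_wpM2l => //.
  apply: increment_ge0; last exact/ltW/weight_gt0.
  by move=> k; exact: weight_leS.
rewrite (sum_linear (increment (weight sigma)) (residual ^~ u) (residual ^~ h)).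
have ru := weighted_residuals L sigma0 hu uB.
have rh := weighted_residuals L sigma0 hsq hH.
have -> : 4 * K * B * H = 2 * (K * H) * B + 2 * (K * B) * H by ring.
by apply: lerD; apply: ler_wpM2l; rewrite ?mulr_ge0.
Qed.

End SupBound.

End FourierAnalysis.

Section SobolevEmbedding.
Context {R : realType} {d : nat} (mu : probability (borel_space R d) R).
Hypotheses (hd : (0 < d)%N) (hmu : rotation_invariant mu).
Context (Z : nat -> nat) (Y : nat -> nat -> 'rV[R]_d.+1 -> R).
Hypothesis hY : harmonic_basis mu Z Y.
Local Notation rV := ('rV[R]_d.+1).
Local Notation S := (@sphere R d).
Local Notation mS := (@sphere R d : set (borel_space R d)).
Local Notation dsum := (dsum Z).
Local Notation ip := (ip mu).
Local Notation comb := (comb Z Y).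
Local Notation coef := (coef mu Y).
Local Notation fourier_sum := (fourier_sum mu Z Y).
Local Notation residual := (residual mu Z Y).
Local Notation sob := (sob mu Z Y).
Local Notation sqint := (sqint mu).
Implicit Types (u v : rV -> R) (c : nat -> nat -> R) (x : rV).

Lemma ip_eq0_ae u : sqint u -> ip u u = 0 ->
  {ae mu, forall x : borel_space R d, S x -> u x = 0}.
Proof.
move=> hu u0; case: (hu) => mu_ iu.
have m2 : measurable_fun mS (EFin \o (fun x : borel_space R d => u x * u x)).
  by apply/measurable_EFinP; exact: measurable_funM.
have [h _] := ae_eq_integral_abs mu measurable_sphere m2.
have : (\int[mu]_(x in mS) `|(u x * u x)%R%:E| = 0)%E.
  rewrite (_ : 0%E = (ip u u)%:E); last by rewrite u0.
  rewrite /ip sint_fine fineK; last first.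
    apply: integrable_fin_num; first exact: measurable_sphere.
    exact: sqint_integrableM.
  by apply: eq_integral => x _; rewrite /= ger0_norm // -expr2 sqr_ge0.
move=> /h; apply: filterS => x xu Sx.
have [/eqP] := xu Sx.
by rewrite mulf_eq0 orbb => /eqP.
Qed.

Section SupBound.
Variables (sigma K : R).
Hypothesis K0 : 0 <= K.
Hypothesis hK : forall n c x, S x ->
  comb n c x ^+ 2 <= K * dsum n (fun l k => weight sigma l * c l k ^+ 2).

Lemma fourier_sum_increment u n m x : S x -> (n <= m)%N ->
  (fourier_sum m u x - fourier_sum n u x) ^+ 2 <=
  K * (sob sigma m u - sob sigma n u).
Proof.
move=> Sx nm; pose c l k := if (n <= l)%N then coef u l k else 0.
have -> : fourier_sum m u x - fourier_sum n u x = comb m c x.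
  rewrite /fourier_sum /comb (dsum_widen _ _ nm) -mulN1r -dsumZ -dsumD.
  apply: eq_dsum => l k _ _; rewrite /c; case: ltnP => _.
    by rewrite mulN1r subrr mul0r.
  by rewrite mulr0 addr0.
have -> : sob sigma m u - sob sigma n u =
    dsum m (fun l k => weight sigma l * c l k ^+ 2).
  rewrite /sob (dsum_widen _ _ nm) -[X in _ - X]mul1r -mulNr -dsumZ -dsumD.
  apply: eq_dsum => l k _ _; rewrite /c; case: ltnP => _.
    by rewrite mulN1r subrr expr0n mulr0.
  by rewrite mulr0 addr0.
exact: hK.
Qed.

Lemma sob_nondecreasing u : nondecreasing_seq (fun n => sob sigma n u).
Proof.
move=> n m nm; apply: dsum_le => // l k _.
by rewrite mulr_ge0 ?sqr_ge0 // ltW // weight_gt0.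
Qed.

(** Sobolev embedding: the Fourier series converges uniformly on the sphere,
    hence to a continuous representative. *)
Lemma sobolev_embedding u B : sqint u -> (forall n, sob sigma n u <= B) ->
  exists g, scont g /\ {ae mu, forall x : borel_space R d, S x -> g x = u x}.
Proof.
move=> hu uB.
have cvs : cvgn (fun n => sob sigma n u).
  apply: nondecreasing_is_cvgn; first exact: sob_nondecreasing.
  by exists B => _ [n _ <-].
set s := limn (fun n => sob sigma n u) in cvs.
pose t n := K * (s - sob sigma n u).
have t0 : t @ \oo --> 0.
  rewrite -(mulr0 K) -(subrr s); apply: cvgMr; apply: cvgB; [exact: cvg_cst|exact: cvs].
have tP n m x : S x -> (n <= m)%N ->
    (fourier_sum m u x - fourier_sum n u x) ^+ 2 <= t n.
  move=> Sx nm; apply: le_trans (fourier_sum_increment u Sx nm) _.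
  rewrite ler_wpM2l // lerD2r.
  exact: (nondecreasing_cvgn_le (@sob_nondecreasing u) cvs).
have small e : 0 < e -> exists n, t n < e ^+ 2.
  move=> e0; have /cvgrPdist_lt/(_ _ (exprn_gt0 2 e0))[n _ nP] := t0.
  exists n; have := nP n (leqnn n); rewrite sub0r normrN.
  exact/le_lt_trans/ler_norm.
have cauchy x : S x -> cvgn (fun n => fourier_sum n u x).
  move=> Sx; apply/cauchy_cvgP/cauchy_exP => e e0.
  have [n tn] := small e e0; exists (fourier_sum n u x); exists n => // m /= nm.
  rewrite -ball_normE /ball_ /= distrC -(ltr_pXn2r (n := 2)) ?nnegrE ?(ltW e0) //.
  rewrite real_normK ?num_real //; exact: le_lt_trans (tP n m x Sx nm) tn.
pose g x := limn (fun n => fourier_sum n u x).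
have gP n x : S x -> (g x - fourier_sum n u x) ^+ 2 <= t n.
  move=> Sx.
  have lim : (fun m => (fourier_sum m u x - fourier_sum n u x) ^+ 2) @ \oo -->
      (g x - fourier_sum n u x) ^+ 2.
    have c : (fun m => fourier_sum m u x - fourier_sum n u x) @ \oo -->
        g x - fourier_sum n u x.
      by apply: cvgB; [exact: (cauchy x Sx)|exact: cvg_cst].
    by rewrite expr2; under eq_fun do rewrite expr2; exact: cvgM.
  by apply: cvgr_to_le lim _; exists n => // m /= nm; exact: tP.
have gS n e x : t n < e ^+ 2 -> 0 < e -> S x -> `|g x - fourier_sum n u x| < e.
  move=> tn e0 Sx; rewrite -(ltr_pXn2r (n := 2)) ?nnegrE ?(ltW e0) //.
  by rewrite real_normK ?num_real //; exact: le_lt_trans (gP n x Sx) tn.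
have gc : scont g.
  apply/scontP => x Sx; apply/cvgrPdist_lt => e e0.
  have e3 : 0 < e / 3 by rewrite divr_gt0.
  have [n tn] := small _ e3.
  have /scontP/(_ x Sx)/cvgrPdist_lt/(_ _ e3) := fourier_sum_scont hY n u.
  rewrite /within /=; apply: (@filterS _ (nbhs x)) => y + Sy => /(_ Sy).
  have := gS n _ x tn e3 Sx; have := gS n _ y tn e3 Sy.
  rewrite !ltr_norml => /andP[? ?] /andP[? ?] /andP[? ?]; apply/andP; split; lra.
exists g; split=> //.
have hg := sqint_scont mu gc.
have hug : sqint (fun x => g x - u x) by exact: sqintB.
have : {ae mu, forall x : borel_space R d, S x -> g x - u x = 0}.
  apply: ip_eq0_ae => //; apply/eqP; rewrite eq_le ip_ge0 andbT.
  have lim : (fun n => 2 * t n + 2 * residual n u) @ \oo --> 2 * 0 + 2 * (0 : R).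
    by apply: cvgD; apply: cvgMr; [exact: t0|exact: (parseval hY)].
  rewrite mulr0 addr0 in lim; apply: cvgr_to_ge lim _; apply: nearW => n.
  have hf := fourier_sum_sqint hY n u.
  have h1 : sqint (fun x => g x - fourier_sum n u x) by exact: sqintB.
  have h2 : sqint (fun x => fourier_sum n u x - u x) by exact: sqintB.
  rewrite (eq_ip _ (u' := fun x => (g x - fourier_sum n u x) + (fourier_sum n u x - u x))
    (v' := fun x => (g x - fourier_sum n u x) + (fourier_sum n u x - u x))); first last.
  - by move=> x _; ring.
  - by move=> x _; ring.
  apply: le_trans (ip_addle h1 h2) _; apply: lerD; rewrite ler_pM2l //.
    have i1 : ip (fun=> 1) (fun=> 1) = 1.
      by apply: etrans (sint_cst hmu 1); apply: eq_sint => x _; rewrite mulr1.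
    rewrite -[t n]mulr1 -i1; apply: le_ip => //; first exact: sqint_cst.
    by move=> x Sx; rewrite expr1n mulr1; exact: gP.
  rewrite /residual le_eqVlt; apply/orP; left; apply/eqP; apply: eq_sint => x _.
  by ring.
by apply: filterS => x h Sx; apply/eqP; rewrite -subr_eq0 h.
Qed.

End SupBound.
End SobolevEmbedding.

(** * Complex-valued functions and designs *)

Section ComplexFunctions.
Context {R : realType} {d : nat} (mu : probability (borel_space R d) R).
Hypotheses (hd : (0 < d)%N) (hmu : rotation_invariant mu).
Context (Z : nat -> nat) (Y : nat -> nat -> 'rV[R]_d.+1 -> R).
Hypothesis hY : harmonic_basis mu Z Y.
Local Notation rV := ('rV[R]_d.+1).
Local Notation S := (@sphere R d).
Local Notation mS := (@sphere R d : set (borel_space R d)).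
Local Notation dsum := (dsum Z).
Local Notation coef := (coef mu Y).
Local Notation sob := (sob mu Z Y).
Local Notation sqint := (sqint mu).
Implicit Types (u v : rV -> R) (f g : rV -> R[i]) (x : rV).

Definition re f x : R := complex.Re (f x).
Definition im f x : R := complex.Im (f x).

Lemma in_L2_sqint f : in_L2 mu f <-> sqint (re f) /\ sqint (im f).
Proof.
have E x : Normc.normc (f x) ^+ 2 = re f x ^+ 2 + im f x ^+ 2.
  rewrite /re /im; case: (f x) => a b /=.
  by rewrite sqr_sqrtr // addr_ge0 ?sqr_ge0.
have L2E : (\int[mu]_(x in mS) `|(EFin \o (fun x : rV => (re f x ^+ 2 + im f x ^+ 2)%R)) x|)%E
    = L2sq mu f.
  apply: eq_integral => x _ /=; rewrite E ger0_norm //.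
  by rewrite addr_ge0 ?sqr_ge0.
split=> [[mr mi fin]|[[mr ir] [mi ii]]].
  have isum : sintegrable mu (fun x => re f x ^+ 2 + im f x ^+ 2).
    apply/integrableP; split; last by rewrite L2E.
    apply/measurable_EFinP; apply: measurable_funD; exact: measurable_funX.
  split; split => //; apply: le_sintegrable isum; try exact: measurable_funX.
    by move=> x _; rewrite ger0_norm ?sqr_ge0 // lerDl sqr_ge0.
  by move=> x _; rewrite ger0_norm ?sqr_ge0 // lerDr sqr_ge0.
split => //; rewrite -L2E.
by have /integrableP[] := sintegrableD ir ii.
Qed.

Lemma fcoefE f l k : fcoef mu Y f l k = (coef (re f) l k +i* coef (im f) l k)%C.
Proof.
apply/eqP; rewrite eq_complex /=; apply/andP; split; apply/eqP.
  apply: eq_sint => x _; rewrite /re; case: (f x) => a b /=.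
  by rewrite mulr0 subr0.
apply: eq_sint => x _; rewrite /im; case: (f x) => a b /=.
by rewrite mulr0 add0r.
Qed.

Lemma sobolev_partial_sum s f n :
  (\sum_(0 <= l < n) \sum_(k < Z l)
    ((1 + l%:R) `^ (2 * s) * Normc.normc (fcoef mu Y f l k) ^+ 2)%:E)%E =
  (sob s n (re f) + sob s n (im f))%:E.
Proof.
rewrite -dsumD big_mkord /dsum -sumEFin; apply: eq_bigr => l _.
rewrite -sumEFin; apply: eq_bigr => k _; congr EFin.
rewrite fcoefE /= sqr_sqrtr ?addr_ge0 ?sqr_ge0 //.
by rewrite mulrDr.
Qed.

Lemma sobolev_term_ge0 s f l : (0 <= \sum_(k < Z l)
    ((1 + l%:R) `^ (2 * s) * Normc.normc (fcoef mu Y f l k) ^+ 2)%:E)%E.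
Proof.
by apply: sume_ge0 => k _; rewrite lee_fin mulr_ge0 ?powR_ge0 ?sqr_ge0.
Qed.

Lemma sobolev_norm_le s f B : 0 <= B ->
  (forall n, sob s n (re f) + sob s n (im f) <= B ^+ 2) ->
  (sobolev_norm mu Z Y s f <= B%:E)%E.
Proof.
move=> B0 hB; rewrite /sobolev_norm.
have -> : B%:E = sqrte ((B ^+ 2)%:E) by rewrite /= sqrtr_sqr ger0_norm.
rewrite lee_sqrt ?lee_fin ?sqr_ge0 //; apply: lime_le.
  by apply: is_cvg_nneseries => l _ _; exact: sobolev_term_ge0.
by apply: nearW => n; rewrite sobolev_partial_sum lee_fin.
Qed.

Lemma sobolev_norm_fin s f : (sobolev_norm mu Z Y s f < +oo)%E ->
  exists2 B : R, 0 <= B & sobolev_norm mu Z Y s f = B%:E /\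
    forall n, sob s n (re f) + sob s n (im f) <= B ^+ 2.
Proof.
rewrite /sobolev_norm; set T := limn _.
have T0 : (0 <= T)%E by apply: nneseries_ge0 => l _ _; exact: sobolev_term_ge0.
have Tn n : ((sob s n (re f) + sob s n (im f))%:E <= T)%E.
  rewrite -sobolev_partial_sum.
  by apply: nneseries_lim_ge => l _ _; exact: sobolev_term_ge0.
move: T T0 Tn => [r| |] //= r0 Tn _; exists (Num.sqrt r); first exact: sqrtr_ge0.
split => // n; rewrite sqr_sqrtr -?lee_fin //.
Qed.

(** Uniqueness of the continuous representative, as the measure charges every
    cap of the sphere. *)
Lemma crep_unique f gr gi : scont gr -> scont gi ->
  {ae mu, forall x : borel_space R d, S x -> gr x = re f x} ->
  {ae mu, forall x : borel_space R d, S x -> gi x = im f x} ->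
  forall x, S x -> crep mu f x = (gr x +i* gi x)%C.
Proof.
move=> cr ci er ei.
have Sae : {ae mu, forall x : borel_space R d, S x}.
  exists (~` mS); split => //; first exact: (measurableC (@measurable_sphere R d)).
  apply: etrans (probability_setC mu (@measurable_sphere R d)) _.
  by rewrite (_ : mu mS = 1%E) ?subee //; exact: hmu.1.
have : [set g | scontinuous g /\ {ae mu, forall x : borel_space R d, g x = f x}]
    (crep mu f).
  apply: xgetPex; exists (fun x => (gr x +i* gi x)%C); split.
    by split; [case: cr|case: ci].
  move: Sae er ei; apply: (@filterS3 _ (almost_everywhere mu)) => x Sx /(_ Sx) rx /(_ Sx) ix.
  by rewrite rx ix /re /im; case: (f x).
move=> [[cr' ci'] e] x Sx; apply/eqP; rewrite eq_complex /=; apply/andP; split; apply/eqP.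
  apply: (scont_ae_eq hmu hd (Scont cr') cr) => //.
  by move: e er; apply: (@filterS2 _ (almost_everywhere mu)) => y -> h /h ->.
apply: (scont_ae_eq hmu hd (Scont ci') ci) => //.
by move: e ei; apply: (@filterS2 _ (almost_everywhere mu)) => y -> h /h ->.
Qed.

Lemma csint_real u : csint mu (fun x => (u x)%:C%C) = (sint mu u)%:C%C.
Proof.
apply/eqP; rewrite eq_complex /= eqxx /=; apply/eqP.
exact: (sint_cst hmu).
Qed.

Definition quadrature n (X : 'I_n -> rV) u : R := n%:R^-1 * \sum_j u (X j).

(** A real integrand is a complex one with zero imaginary part, and any of its
    continuous representatives gives its point values. *)
Lemma qmc_real (sigma c : R) n (X : 'I_n -> rV) v vc B :
  (forall j, S (X j)) ->
  (forall g, in_sobolev mu Z Y sigma g ->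
     ((Normc.normc (n%:R^-1 * (\sum_j crep mu g (X j)) - csint mu g))%:E
      <= c%:E * sobolev_norm mu Z Y sigma g)%E) ->
  0 <= c -> sqint v -> scont vc ->
  {ae mu, forall x : borel_space R d, S x -> vc x = v x} ->
  0 <= B -> (forall m, sob sigma m v <= B ^+ 2) ->
  `|quadrature X vc - sint mu v| <= c * B.
Proof.
move=> SX hq c0 hv cv ev B0 hB; pose g x := (v x)%:C%C.
have h0 : sqint (im g) by exact: sqint_cst.
have sob0 m : sob sigma m (im g) = 0.
  rewrite /sob /dsum big1 // => l _; rewrite big1 // => k _.
  by rewrite /coef ipC [X in _ * X ^+ 2](_ : _ = 0) ?expr0n ?mulr0 //; exact: ip0r.
have gB : (sobolev_norm mu Z Y sigma g <= B%:E)%E.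
  by apply: sobolev_norm_le => // m; rewrite sob0 addr0; exact: hB.
have hg : in_sobolev mu Z Y sigma g.
  by split; [apply/in_L2_sqint|exact: le_lt_trans gB (ltry _)].
have := le_trans (hq g hg) (lee_wpmul2l _ gB); rewrite lee_fin => /(_ c0).
rewrite -EFinM lee_fin; apply: le_trans.
have cg x : S x -> crep mu g x = (vc x)%:C%C.
  move=> Sx; apply: (crep_unique cv (scont_cst 0)) => //.
  exact: aeW.
rewrite csint_real; under eq_bigr do rewrite cg //.
rewrite -(rmorph_sum (real_complex R)) -(rmorph_nat (real_complex R)).
rewrite -fmorphV -rmorphM -rmorphB /=.
by rewrite expr0n addr0 sqrtr_sqr.
Qed.

End ComplexFunctions.

(** * Multipliers of the kernel *)

Section Multipliers.
Context {R : realType}.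
Implicit Types (r a : R) (l : nat).

Lemma one_powR (t : R) : 1 `^ t = 1.
Proof. by rewrite powR1. Qed.

Lemma weightE (s : R) l : weight s l = ((1 + l%:R) `^ s) ^+ 2.
Proof. by rewrite /weight mulrC powRrM powR_mulrn ?powR_ge0. Qed.

(** Low frequencies use the approximation order of the kernel, high
    frequencies the smoothness gap between the two norms. *)
Lemma convolution_multiplier (sigma m tau c1 c2 rho a : R) l :
  0 <= m <= sigma -> 0 <= tau <= m -> 0 < rho < 1 -> 0 < c1 -> 0 < c2 ->
  (l%:Z <= Num.floor (rho^-1 - 1) -> `|1 - a| <= c1 * l%:R `^ m * rho `^ m) ->
  (Num.floor (rho^-1 - 1) < l%:Z -> a <= c2) ->
  ((0 < l)%N -> 0 <= a) ->
  weight tau l * (1 - a) ^+ 2 <=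
    ((c1 + 1 + c2) * rho `^ (m - tau)) ^+ 2 * weight sigma l.
Proof.
move=> /andP[m0 ms] /andP[t0 tm] /andP[r0 r1] c10 c20 lo hi a0.
set M := c1 + 1 + c2; set b : R := 1 + l%:R.
have b1 : 1 <= b by rewrite lerDl.
have b0 : 0 < b by rewrite (lt_le_trans _ b1).
have M0 : 0 <= M by rewrite !addr_ge0 // ltW.
rewrite !weightE -(real_normK (num_real (1 - a))) -!exprMn -/b.
rewrite lerXn2r ?nnegrE ?mulr_ge0 ?powR_ge0 //.
have rE : rho `^ m = rho `^ (m - tau) * rho `^ tau.
  by rewrite -powRD ?subrK //; apply/implyP => _; rewrite gt_eqF.
have [lle|lgt] := lerP l%:Z (Num.floor (rho^-1 - 1)).
  have br : b * rho <= 1.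
    rewrite -ler_pdivlMr // div1r -lerBrDl.
    by move: lle; rewrite floor_ge_int -pmulrn.
  have btr : b `^ tau * rho `^ tau <= 1.
    rewrite -powRM ?(ltW b0) ?(ltW r0) // -(one_powR tau).
    by apply: ge0_ler_powR; rewrite ?nnegrE ?mulr_ge0 ?(ltW b0) ?(ltW r0).
  have lm : l%:R `^ m <= b `^ sigma.
    apply: le_trans (_ : b `^ m <= _); last by rewrite ler_powR.
    by apply: ge0_ler_powR; rewrite ?nnegrE ?(ltW b0) // lerDr.
  apply: le_trans (ler_wpM2l (powR_ge0 _ _) (lo lle)) _.
  rewrite rE [leLHS](_ : _ = c1 * rho `^ (m - tau) * ((b `^ tau * rho `^ tau) * l%:R `^ m)); last by ring.
  apply: ler_pM.
  - by rewrite mulr_ge0 ?powR_ge0 // ltW.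
  - by rewrite !mulr_ge0 ?powR_ge0.
  - by rewrite ler_wpM2r ?powR_ge0 // /M -addrA lerDl addr_ge0 // ltW.
  - by rewrite -[leRHS]mul1r ler_pM ?mulr_ge0 ?powR_ge0.
have br : 1 <= b * rho.
  rewrite -ler_pdivrMr // div1r -lerBlDl.
  by move: lgt; rewrite floor_lt_int -pmulrn => /ltW.
have l0 : (0 < l)%N.
  rewrite lt0n; apply/eqP => l0; move: br; rewrite /b l0 addr0 mul1r leNgt.
  by rewrite r1.
have aM : `|1 - a| <= M.
  have := hi lgt; have := a0 l0; rewrite ler_norml /M => ? ?.
  by apply/andP; split; lra.
have bst : b `^ tau = b `^ sigma * b `^ (- (sigma - tau)).
  by rewrite -powRD; [congr (_ `^ _); ring|apply/implyP => _; rewrite gt_eqF].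
have bm : b `^ (- (sigma - tau)) <= rho `^ (m - tau).
  apply: le_trans (_ : b `^ (- (m - tau)) <= _).
    by rewrite ler_powR // lerN2 lerB.
  rewrite powRN -[leLHS]mul1r ler_pdivrMr ?powR_gt0 // mulrC.
  rewrite -powRM ?(ltW b0) ?(ltW r0) // -(one_powR (m - tau)).
  by apply: ge0_ler_powR; rewrite ?nnegrE ?mulr_ge0 ?(ltW b0) ?(ltW r0) // subr_ge0.
rewrite bst [leLHS](_ : _ = b `^ sigma * (b `^ (- (sigma - tau)) * `|1 - a|)); last by ring.
rewrite [leRHS](_ : _ = b `^ sigma * (rho `^ (m - tau) * M)); last by ring.
by rewrite ler_wpM2l ?powR_ge0 // ler_pM ?powR_ge0.
Qed.

Lemma powR_le_base (x y s : R) : 0 <= s -> 0 < x <= y -> x `^ s <= y `^ s.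
Proof.
move=> s0 /andP[x0 xy]; apply: ge0_ler_powR; rewrite ?nnegrE ?(ltW x0) //.
by rewrite ltW // (lt_le_trans x0).
Qed.

(** In positive degrees this is [rho (1 + l) <= 1 + rho l]; in degree zero,
    where the decay of the kernel says nothing, its approximation order bounds
    [a]. *)
Lemma smoothing_multiplier (s m c1 c4 rho a : R) l :
  0 <= s -> 0 <= m -> 0 < rho < 1 -> 0 < c1 -> 0 < c4 ->
  (l%:Z <= Num.floor (rho^-1 - 1) -> `|1 - a| <= c1 * l%:R `^ m * rho `^ m) ->
  ((0 < l)%N -> 0 <= a <= c4 * (1 + rho * l%:R) `^ (- (2 * s))) ->
  weight s l * a ^+ 2 <= ((1 + c1 + c4) * rho `^ (- s)) ^+ 2.
Proof.
move=> s0 m0 /andP[r0 r1] c10 c40 lo hi.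
set M := 1 + c1 + c4; have M0 : 0 <= M by rewrite !addr_ge0 // ltW.
have rs1 : 1 <= rho `^ (- s).
  rewrite powRN -[leLHS]invr1 lef_pV2 ?posrE ?powR_gt0 //.
  by rewrite -(one_powR s) powR_le_base // r0 ltW.
rewrite weightE -(real_normK (num_real a)) -exprMn lerXn2r ?nnegrE ?mulr_ge0 ?powR_ge0 //.
case: l lo hi => [lo _|l _ /(_ isT)/andP[a0 aM]].
  rewrite addr0 powR1 mul1r; apply: le_trans (_ : 1 + c1 <= _).
    have fl : 0%:Z <= Num.floor (rho^-1 - 1).
      by rewrite floor_ge_int subr_ge0 -[leLHS]invr1 lef_pV2 ?posrE // ltW.
    have := lo fl; set t := 0%:R `^ m * rho `^ m.
    have t1 : t <= 1.
      rewrite -[leRHS]mulr1; apply: ler_pM; rewrite ?powR_ge0 //.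
        by rewrite /powR eqxx; case: eqP.
      by rewrite -(one_powR m) powR_le_base // r0 ltW.
    move=> lo'; have : `|1 - a| <= c1.
      by apply: le_trans lo' _; rewrite -mulrA -[leRHS]mulr1 ler_pM2l.
    by rewrite !ler_norml => /andP[? ?]; apply/andP; split; lra.
  rewrite -[leLHS]mulr1 ler_pM ?addr_ge0 ?(ltW c10) //.
  by rewrite lerDl ltW.
rewrite ger0_norm //; set b : R := 1 + l.+1%:R; set e := 1 + rho * l.+1%:R.
have e1 : 1 <= e by rewrite lerDl mulr_ge0 // ltW.
have e0 : 0 < e by rewrite (lt_le_trans _ e1).
have b0 : 0 < b by rewrite addr_gt0.
have be : b `^ s <= rho `^ (- s) * e `^ s.
  have rsn : rho `^ s != 0 by rewrite gt_eqF // powR_gt0.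
  rewrite powRN mulrC ler_pdivlMr ?powR_gt0 // -powRM ?(ltW b0) ?(ltW r0) //.
  by rewrite powR_le_base // mulr_gt0 //= /b /e; lra.
have ee : e `^ s * e `^ (- (2 * s)) <= 1.
  rewrite -powRD; last by apply/implyP => _; rewrite gt_eqF.
  by rewrite -[leRHS](powRr0 e) ler_powR //; lra.
apply: le_trans (ler_pM _ _ be aM) _; rewrite ?powR_ge0 //.
rewrite [leLHS](_ : _ = c4 * (e `^ s * e `^ (- (2 * s))) * rho `^ (- s)); last by ring.
rewrite ler_wpM2r ?powR_ge0 //; apply: le_trans (_ : c4 * 1 <= _).
  by rewrite ler_pM2l.
by rewrite mulr1 /M lerDr addr_ge0 // ltW.
Qed.

End Multipliers.

(** * The zonal kernel and its quasi-interpolant *)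

Section ZonalKernel.
Context {R : realType} {d : nat} (mu : probability (borel_space R d) R).
Hypotheses (hd : (0 < d)%N) (hmu : rotation_invariant mu).
Context (Z : nat -> nat) (Y : nat -> nat -> 'rV[R]_d.+1 -> R).
Hypothesis hY : harmonic_basis mu Z Y.
Context (phi : R -> R).
Hypothesis hphi : continuous_0oo phi.
Local Notation rV := ('rV[R]_d.+1).
Local Notation S := (@sphere R d).
Implicit Types (x y z : rV) (rho : R).

Lemma Phi_scont rho z : scont (fun x => Phi phi rho (x - z)).
Proof.
apply: continuous_scont => x; case: hphi => /subspace_continuousP pc _.
have fx : enorm (rho^-1 *: (y - z)) @[y --> x] --> enorm (rho^-1 *: (x - z)).
  apply: (@enorm_cvg _ _ _ (fun y : rV => rho^-1 *: (y - z)) x (nbhs x)).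
  by apply: cvgZr; apply: cvgB; [exact: cvg_id|exact: cvg_cst].
have p0 w : `[0, +oo[%classic (enorm (w : rV)) by rewrite /= in_itv /= enorm_ge0.
move=> A /(pc _ (p0 _)) /=; rewrite /within /= => wA.
move: (fx _ wA); apply: (@filterS _ (nbhs x)) => y Ay.
exact: Ay (p0 _).
Qed.

Lemma PhiN rho x y : Phi phi rho (x - y) = Phi phi rho (y - x) :> R.
Proof. by rewrite /Phi -opprB scalerN enormN. Qed.

(** This makes the kernel symmetric, as its normalization only involves one of
    the two points. *)
Lemma Lambda_const rho y z : S y -> S z -> Lambda mu phi rho y = Lambda mu phi rho z.
Proof.
move=> Sy Sz; have [U hU yUz] := rotation_transitive hd Sy Sz.
rewrite /Lambda -(sint_rotation hmu hU (Phi_scont rho z)).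
apply: eq_sint => x _; rewrite /Phi -yUz -mulmxBl scalemxAl; congr phi.
by rewrite !enormE dot_orthogonal //; case: hU.
Qed.

Lemma zonal_sym rho x y : S x -> S y ->
  zonal mu phi rho x y = zonal mu phi rho y x.
Proof. by move=> Sx Sy; rewrite /zonal (Lambda_const rho Sy Sx) PhiN. Qed.

Lemma zonal_scont rho z : scont (fun x => zonal mu phi rho x z).
Proof. by apply: scontZ; exact: Phi_scont. Qed.

Lemma coef_zonal rho (a : nat -> R) l k z :
  fourier_legendre mu Z Y phi rho a -> (k < Z l)%N -> S z ->
  coef mu Y (fun x => zonal mu phi rho x z) l k = a l * Y l k z.
Proof.
move=> ha kl Sz; apply: etrans (ha l k z kl Sz); apply: eq_sint => x Sx.
by rewrite zonal_sym.
Qed.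

Definition real_quasi_interp rho n (X : 'I_n -> rV) (v : rV -> R) x : R :=
  n%:R^-1 * \sum_j v (X j) * zonal mu phi rho x (X j).

Lemma real_quasi_interp_scont rho n (X : 'I_n -> rV) v :
  scont (real_quasi_interp rho X v).
Proof.
by apply: scontZ; apply: scont_sum => j _; apply: scontZ; exact: zonal_scont.
Qed.

Lemma coef_quasi_interp rho a n (X : 'I_n -> rV) v l k :
  fourier_legendre mu Z Y phi rho a -> (forall j, S (X j)) -> (k < Z l)%N ->
  coef mu Y (real_quasi_interp rho X v) l k =
  a l * quadrature X (fun x => v x * Y l k x).
Proof.
move=> ha SX kl; have hYk := Y_sqint hY kl.
have hz j : sqint mu (fun x => zonal mu phi rho x (X j)).
  by apply: sqint_scont; exact: zonal_scont.
rewrite /coef ipC /real_quasi_interp ipZr //; last first.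
  by apply: sqint_sum => j _; exact: sqintZ.
rewrite ip_sumr //; last by move=> j _; exact: sqintZ.
rewrite /quadrature mulrCA; congr (_ * _); rewrite mulr_sumr.
apply: eq_bigr => j _; rewrite ipZr // mulrCA; congr (_ * _).
by rewrite ipC; exact: (coef_zonal ha kl (SX j)).
Qed.

Lemma quasi_interpE rho n (X : 'I_n -> rV) f gr gi x :
  (forall j, crep mu f (X j) = (gr (X j) +i* gi (X j))%C) ->
  quasi_interp mu phi rho X f x =
  (real_quasi_interp rho X gr x +i* real_quasi_interp rho X gi x)%C.
Proof.
move=> fE; rewrite /quasi_interp.
have -> : \sum_j crep mu f (X j) * (zonal mu phi rho x (X j))%:C%C =
    ((\sum_j gr (X j) * zonal mu phi rho x (X j)) +i*
     (\sum_j gi (X j) * zonal mu phi rho x (X j)))%C.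
  elim: (index_enum _) => [|j r IH]; first by rewrite !big_nil.
  rewrite !big_cons IH fE; apply/eqP; rewrite eq_complex /= !mulr0 subr0 add0r.
  by rewrite !eqxx.
rewrite -(rmorph_nat (real_complex R)) -fmorphV.
by apply/eqP; rewrite eq_complex /= !mul0r subr0 addr0 !eqxx.
Qed.

End ZonalKernel.

(** * The quadrature error *)

Section ErrorEstimate.
Context {R : realType} {d : nat} (mu : probability (borel_space R d) R).
Hypotheses (hd : (0 < d)%N) (hmu : rotation_invariant mu).
Context (Z : nat -> nat) (Y : nat -> nat -> 'rV[R]_d.+1 -> R).
Hypothesis hY : harmonic_basis mu Z Y.
Local Notation rV := ('rV[R]_d.+1).
Local Notation S := (@sphere R d).
Local Notation dsum := (dsum Z).
Local Notation coef := (coef mu Y).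
Local Notation comb := (comb Z Y).
Local Notation sob := (sob mu Z Y).
Local Notation sqint := (sqint mu).
Implicit Types (u v : rV -> R) (x y z : rV).

Lemma quadrature_comb n (X : 'I_n -> rV) u m b :
  quadrature X (fun x => u x * comb m b x) =
  dsum m (fun l k => b l k * quadrature X (fun x => u x * Y l k x)).
Proof.
rewrite /quadrature; under eq_bigr do rewrite /comb -dsumZ.
rewrite /dsum exchange_big mulr_sumr; apply: eq_bigr => l _ /=.
rewrite exchange_big mulr_sumr; apply: eq_bigr => k _ /=.
rewrite [RHS]mulrCA [X in _ = _ * X]mulr_sumr; congr (_ * _); apply: eq_bigr => j _.
by rewrite mulrCA.
Qed.

(** The absorption step of the duality argument, where [g] may vanish. *)
Lemma le_sqr_of_le_mul_sqrt (g c : R) : 0 <= g -> 0 <= c -> g <= c * Num.sqrt g -> g <= c ^+ 2.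
Proof.
move=> g0 c0 h; have r0 := sqrtr_ge0 g; have gE := sqr_sqrtr g0.
have : Num.sqrt g * Num.sqrt g <= c * Num.sqrt g by rewrite -expr2 gE.
rewrite -[in X in _ -> X]gE; move: r0; rewrite le_eqVlt => /predU1P[<- _|r0].
  by rewrite expr0n sqr_ge0.
by rewrite ler_pM2r // => rc; rewrite lerXn2r ?nnegrE ?(ltW r0).
Qed.

Section Quadrature.
Variables (sigma tau s K M c B : R) (a : nat -> R).
Variables (n : nat) (X : 'I_n -> rV) (u uc : rV -> R).
Hypotheses (sigma0 : 0 <= sigma) (sE : s = tau + sigma).
Hypotheses (K0 : 0 <= K) (M0 : 0 <= M) (c0 : 0 <= c) (B0 : 0 <= B).
Hypothesis hK : forall m b x, S x ->
  comb m b x ^+ 2 <= K * dsum m (fun l k => weight sigma l * b l k ^+ 2).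
Hypothesis hM : forall l, weight s l * a l ^+ 2 <= M ^+ 2.
Hypotheses (hu : sqint u) (hB : forall m, sob sigma m u <= B ^+ 2).
Hypotheses (cu : scont uc)
  (eu : {ae mu, forall x : borel_space R d, S x -> uc x = u x}).
Hypothesis hq : forall v vc B', sqint v -> scont vc ->
  {ae mu, forall x : borel_space R d, S x -> vc x = v x} -> 0 <= B' ->
  (forall m, sob sigma m v <= B' ^+ 2) ->
  `|quadrature X vc - sint mu v| <= c * B'.

Definition algebra_constant : R := Num.sqrt (2 `^ (2 * sigma) * (4 * K)).

Definition quad_error l k : R := coef u l k - quadrature X (fun x => uc x * Y l k x).

(** The weighted quadrature errors of all products [u * Y l k] are bounded by
    testing the design against the single function [u * h], where [h] is the
    polynomial whose coefficients make the quadrature error of [u * h] equal to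
    the sum [G] to be bounded. *)
Lemma quad_error_bound L :
  dsum L (fun l k => weight tau l * (a l ^+ 2 * quad_error l k ^+ 2)) <=
    (c * (algebra_constant * B * M)) ^+ 2.
Proof.
set G := dsum L _.
pose b l k := weight tau l * a l ^+ 2 * quad_error l k.
have G0 : 0 <= G.
  apply: dsum_ge0 => l k _ _.
  by rewrite mulr_ge0 ?(ltW (weight_gt0 _ _)) // mulr_ge0 ?sqr_ge0.
have hc : scont (comb L b) by exact: (comb_scont hY).
have hh : sqint (comb L b) by exact: sqint_scont.
have GE : sint mu (fun x => u x * comb L b x) - quadrature X (fun x => uc x * comb L b x) = G.
  rewrite quadrature_comb (ip_comb hY L b hu : sint _ _ = _).
  rewrite -[X in _ - X]mul1r -mulNr -dsumZ -dsumD; apply: eq_dsum => l k _ _.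
  by rewrite /b /quad_error; ring.
have hsob m : sob sigma m (comb L b) <= M ^+ 2 * G.
  apply: le_trans (_ : dsum L (fun l k => weight sigma l * b l k ^+ 2) <= _).
    apply: le_trans (dsum_le (n := m) (m := maxn m L) (leq_maxl _ _) _) _.
      by move=> l k _; rewrite mulr_ge0 ?sqr_ge0 // ltW // weight_gt0.
    rewrite (dsum_widen _ _ (leq_maxr m L)); apply: ler_dsum => l k _ kl.
    by rewrite (coef_comb hY) //; case: ifP => // _; rewrite expr0n mulr0.
  rewrite -dsumZ; apply: ler_dsum => l k _ _.
  rewrite [leLHS](_ : _ = weight s l * a l ^+ 2 *
      (weight tau l * (a l ^+ 2 * quad_error l k ^+ 2))).
    apply: ler_wpM2r; last exact: hM.
    by rewrite mulr_ge0 ?(ltW (weight_gt0 _ _)) // mulr_ge0 ?sqr_ge0.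
  have -> : weight s l = weight tau l * weight sigma l.
    rewrite /weight -powRD; last by apply/implyP => _; rewrite gt_eqF // ltr_wpDr.
    by rewrite sE mulrDr.
  by rewrite /b; ring.
pose B' := algebra_constant * B * M * Num.sqrt G.
have B'0 : 0 <= B' by rewrite /B' !mulr_ge0 ?sqrtr_ge0.
have hp : sqint (fun x => u x * comb L b x).
  by apply: eq_sqint (sqint_scontM hc hu) => x _; rewrite mulrC.
have hpB m : sob sigma m (fun x => u x * comb L b x) <= B' ^+ 2.
  have h := sobolev_algebra hY sigma0 K0 hK m hu hB hsob; apply: le_trans h _.
  rewrite /B' !exprMn !sqr_sqrtr // ?mulr_ge0 ?powR_ge0 //.
  by rewrite le_eqVlt; apply/orP; left; apply/eqP; ring.
have := hq hp (scontM cu hc) _ B'0 hpB; rewrite distrC GE ger0_norm //.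
have eup : {ae mu, forall x : borel_space R d, S x -> uc x * comb L b x = u x * comb L b x}.
  by move: eu; apply: (@filterS _ (almost_everywhere mu)) => x xu Sx; rewrite xu.
move=> /(_ eup) h; apply: le_sqr_of_le_mul_sqrt => //; first by rewrite !mulr_ge0 ?sqrtr_ge0.
by rewrite -mulrA.
Qed.

(** The error splits into the multiplier [1 - a] acting on [u] and the
    filtered quadrature errors. *)
Lemma quasi_interp_error (q : rV -> R) M1 L : sqint q ->
  (forall l k, (k < Z l)%N ->
     coef q l k = a l * quadrature X (fun x => uc x * Y l k x)) ->
  (forall l, weight tau l * (1 - a l) ^+ 2 <= M1 ^+ 2 * weight sigma l) ->
  sob tau L (fun x => u x - q x) <=
    2 * (M1 ^+ 2 * B ^+ 2) + 2 * (c * (algebra_constant * B * M)) ^+ 2.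
Proof.
move=> hqq qE h1.
apply: le_trans (_ : 2 * (M1 ^+ 2 * sob sigma L u) +
  2 * dsum L (fun l k => weight tau l * (a l ^+ 2 * quad_error l k ^+ 2)) <= _).
  rewrite /sob -!dsumZ -dsumD; apply: ler_dsum => l k _ kl.
  rewrite (fourier_coefB hY) // qE //.
  have -> : coef u l k - a l * quadrature X (fun x => uc x * Y l k x) =
     (1 - a l) * coef u l k + a l * quad_error l k by rewrite /quad_error; ring.
  set p := (1 - a l) * _; set r := a l * _.
  apply: le_trans (_ : weight tau l * (2 * p ^+ 2 + 2 * r ^+ 2) <= _).
    rewrite ler_wpM2l ?(ltW (weight_gt0 _ _)) //.
    by have := sqr_ge0 (p - r); rewrite sqrrB sqrrD; lra.
  rewrite mulrDr; apply: lerD; last by rewrite /r exprMn mulrCA.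
  rewrite /p exprMn (_ : weight tau l * _ =
    2 * (weight tau l * (1 - a l) ^+ 2 * coef u l k ^+ 2)); last by ring.
  by rewrite ler_pM2l // [leRHS]mulrA ler_wpM2r ?sqr_ge0.
apply: lerD; rewrite ler_pM2l //; last exact: quad_error_bound.
by rewrite ler_wpM2l ?sqr_ge0.
Qed.

End Quadrature.
End ErrorEstimate.

(** * The error estimate *)

Theorem theorem3p4 (R : realType) (d : nat) (hd : (0 < d)%N)
  (mu : probability (borel_space R d) R) (hmu : rotation_invariant mu)
  (Z : nat -> nat) (Y : nat -> nat -> 'rV[R]_d.+1 -> R)
  (hY : harmonic_basis mu Z Y)
  (phi : R -> R) (hphi : continuous_0oo phi)
  (phihat : R -> nat -> R)
  (hphihat : forall rho : R, 0 < rho < 1 ->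
     fourier_legendre mu Z Y phi rho (phihat rho))
  (sigma m tau rho0 : R)
  (hsigma : d%:R / 2 < sigma) (hm : 0 <= m <= sigma) (htau : 0 <= tau <= m)
  (hrho0 : 0 < rho0 < 1)
  (s : R) (hs : s = tau + sigma)
  (c1 c2 c3 c4 : R) (hc1 : 0 < c1) (hc2 : 0 < c2) (hc34 : 0 < c3 <= c4)
  (Hi : forall rho : R, 0 < rho < rho0 ->
     forall l : nat, (l%:Z <= Num.floor (rho^-1 - 1))%R ->
       `|1 - phihat rho l| <= c1 * l%:R `^ m * rho `^ m)
  (Hii : forall rho : R, 0 < rho < rho0 ->
     forall l : nat, (Num.floor (rho^-1 - 1) < l%:Z)%R ->
       phihat rho l <= c2)
  (Hiii : forall rho : R, 0 < rho < rho0 ->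
     forall l : nat, (0 < l)%N ->
       c3 * (1 + rho * l%:R) `^ (- (2 * s)) <= phihat rho l
         <= c4 * (1 + rho * l%:R) `^ (- (2 * s)))
  (N : nat -> nat) (X : forall i, 'I_(N i) -> 'rV[R]_d.+1)
  (hX : qmc_design mu Z Y sigma X) :
  exists C : R, 0 < C /\
    forall f : 'rV[R]_d.+1 -> R[i], in_sobolev mu Z Y sigma f ->
    forall (i : nat) (rho : R), 0 < rho < rho0 ->
      (sobolev_norm mu Z Y tau
         (fun x => (f x - quasi_interp mu phi rho (X i) f x)%R)
       <= (C * (rho `^ (m - tau)
                + rho `^ (- s) * (N i)%:R `^ (- (sigma / d%:R))))%:E
          * sobolev_norm mu Z Y sigma f)%E.
Proof.
have /andP[m0 ms] := hm; have /andP[t0 tm] := htau.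
have /andP[r00 r01] := hrho0; have /andP[c30 c34] := hc34.
have c40 : 0 < c4 by exact: lt_le_trans c34.
have sigma0 : 0 <= sigma by exact: le_trans ms.
have s0 : 0 <= s by rewrite hs addr_ge0.
have [K K0 hK] := comb_sup_bound hd hmu hY hsigma.
have {}K0 := ltW K0.
have [hX1 [C0 [C00 hX2]]] := hX.
pose A := algebra_constant sigma K; have A0 : 0 <= A by exact: sqrtr_ge0.
pose M0 := 1 + c1 + c4; pose M1 := c1 + 1 + c2.
have M00 : 0 <= M0 by rewrite !addr_ge0 // ltW.
have M10 : 0 < M1 by rewrite !addr_gt0.
exists (2 * (M1 + C0 * A * M0)); split.
  by rewrite mulr_gt0 // ltr_wpDr // !mulr_ge0 // ltW.
move=> f [fL2 ffin] i rho /[dup] hrho /andP[r0 rr0].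
have rho1 : 0 < rho < 1 by rewrite r0 (lt_trans rr0).
have [n0 Xinj SX] := hX1 i.
have /in_L2_sqint[hre him] := fL2.
have [B B0 [-> hB]] := sobolev_norm_fin ffin.
have sob0 v n : 0 <= sob mu Z Y sigma n v.
  apply: dsum_ge0 => l k _ _.
  by rewrite mulr_ge0 ?sqr_ge0 // ltW // weight_gt0.
have hBr n : sob mu Z Y sigma n (re f) <= B ^+ 2.
  by apply: le_trans (hB n); rewrite lerDl.
have hBi n : sob mu Z Y sigma n (im f) <= B ^+ 2.
  by apply: le_trans (hB n); rewrite lerDr.
have [gr [cgr egr]] := sobolev_embedding hmu hY K0 hK hre hBr.
have [gi [cgi egi]] := sobolev_embedding hmu hY K0 hK him hBi.
have fE j : crep mu f (X i j) = (gr (X i j) +i* gi (X i j))%C.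
  exact: (crep_unique hd hmu cgr cgi egr egi).
set P := (N i)%:R `^ (- (sigma / d%:R)).
have P0 : 0 <= P by exact: powR_ge0.
have cP0 : 0 <= C0 * P by rewrite mulr_ge0 // ltW.
pose a := phihat rho.
have ha : fourier_legendre mu Z Y phi rho a by exact: hphihat.
have hM l : weight s l * a l ^+ 2 <= (M0 * rho `^ (- s)) ^+ 2.
  apply: (smoothing_multiplier (m := m)) => // [|l0]; first exact: Hi.
  have /andP[lo ->] := Hiii rho hrho l l0; rewrite andbT.
  by apply: le_trans lo; rewrite mulr_ge0 ?powR_ge0 // ltW.
have hM1 l : weight tau l * (1 - a l) ^+ 2 <=
    (M1 * rho `^ (m - tau)) ^+ 2 * weight sigma l.
  apply: convolution_multiplier => // [||l0]; [exact: Hi|exact: Hii|].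
  have /andP[lo _] := Hiii rho hrho l l0.
  by apply: le_trans lo; rewrite mulr_ge0 ?powR_ge0 // ltW.
have M00' : 0 <= M0 * rho `^ (- s) by rewrite mulr_ge0 ?powR_ge0.
have hq v vc B' : sqint mu v -> scont vc ->
    {ae mu, forall x : borel_space R d, sphere (x : 'rV[R]_d.+1) -> vc x = v x} ->
    0 <= B' -> (forall k, sob mu Z Y sigma k v <= B' ^+ 2) ->
    `|quadrature (X i) vc - sint mu v| <= C0 * P * B'.
  move=> hv cv ev B'0 hB'.
  exact: (qmc_real hd hmu SX (hX2 i) cP0 hv cv ev B'0 hB').
(* The bound for each of the real and imaginary parts; their squares add up to
   the square of [2 * D * B]. *)
pose D := M1 * rho `^ (m - tau) + C0 * P * (A * (M0 * rho `^ (- s))).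
have part v vc L : sqint mu v -> (forall k, sob mu Z Y sigma k v <= B ^+ 2) ->
    scont vc ->
    {ae mu, forall x : borel_space R d, sphere (x : 'rV[R]_d.+1) -> vc x = v x} ->
    sob mu Z Y tau L (fun x => v x - real_quasi_interp mu phi rho (X i) vc x)
      <= 2 * (D * B) ^+ 2.
  move=> hv hBv cv ev.
  have hqs : sqint mu (real_quasi_interp mu phi rho (X i) vc).
    by apply: sqint_scont; exact: real_quasi_interp_scont.
  have qE l k : (k < Z l)%N -> coef mu Y (real_quasi_interp mu phi rho (X i) vc) l k
      = a l * quadrature (X i) (fun x => vc x * Y l k x).
    exact: coef_quasi_interp.
  apply: le_trans (quasi_interp_error hY sigma0 hs K0 M00' cP0 B0 hK hM hv
    hBv cv ev hq L hqs qE hM1) _.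
  set p := M1 * rho `^ (m - tau); set r := C0 * P * _.
  have -> : D * B = p * B + r by rewrite /D /r /p -/A; ring.
  have pB : 0 <= p * B by rewrite !mulr_ge0 ?powR_ge0 // ltW.
  have r0' : 0 <= r by rewrite /r !mulr_ge0 ?powR_ge0 // ltW.
  by rewrite -exprMn; nra.
apply: le_trans (_ : (2 * D * B)%:E <= _)%E.
  apply: sobolev_norm_le => [|n].
    by rewrite /D !mulr_ge0 ?addr_ge0 ?mulr_ge0 ?powR_ge0 // ltW.
  have -> : re (fun x => (f x - quasi_interp mu phi rho (X i) f x)%R) =
      (fun x => re f x - real_quasi_interp mu phi rho (X i) gr x).
    by apply/funext => x; rewrite /re (quasi_interpE _ _ _ fE); case: (f x).
  have -> : im (fun x => (f x - quasi_interp mu phi rho (X i) f x)%R) =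
      (fun x => im f x - real_quasi_interp mu phi rho (X i) gi x).
    by apply/funext => x; rewrite /im (quasi_interpE _ _ _ fE); case: (f x).
  have := part _ _ n hre hBr cgr egr; have := part _ _ n him hBi cgi egi.
  by rewrite -[2 * D * B]mulrA [X in _ -> _ -> _ <= X]exprMn; lra.
rewrite -EFinM lee_fin ler_wpM2r // -mulrA ler_pM2l //.
set al := rho `^ (m - tau); set be := rho `^ (- s) * P.
have al0 : 0 <= al by exact: powR_ge0.
have be0 : 0 <= be by rewrite mulr_ge0 ?powR_ge0.
have w0 : 0 <= C0 * A * M0 by rewrite !mulr_ge0 // ltW.
have -> : D = M1 * al + C0 * A * M0 * be by rewrite /D /al /be; ring.
rewrite [leRHS]mulrDr; apply: lerD; rewrite ler_wpM2r // ?lerDl ?lerDr //.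
exact: ltW.
Qed.
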